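(* Let $X$ and $U$ be Hilbert spaces, let $A:D(A)\subset X\to X$ be the generator of a strongly continuous contraction semigroup $(T(t))_{t\ge0}$ on $X$, and let $B:U\to X$ be a bounded linear operator. Suppose that there exists $\alpha>0$ such that $\|T(t)\|\le e^{-\alpha t}$ for all $t>0$, and let $\sigma:U\to U$ be an admissible feedback function. Then the function $$V(x)=\|x\|_X^2,\quad x\in X,$$ is an ISS Lyapunov function with respect to $C([0,\infty);U)$ for the system $$(\Sigma_{SLD})\qquad \dot x(t)=Ax(t)-B\sigma\big(B^*x(t)+d(t)\big),\quad x(0)=x_0,$$ and System $(\Sigma_{SLD})$ is ISS with respect to $C([0,\infty);U)$.
   Context: Admissible feedback function: $\sigma:U\to U$ such that (1) $\sigma(0)=0$; (2) $\sigma$ is locally Lipschitz continuous, i.e. for every $r>0$ there is $k_r>0$ with $\|\sigma(u)-\sigma(v)\|_U\le k_r\|u-v\|_U$ for all $u,v\in U$ with $\|u\|_U,\|v\|_U\le r$; (3) $\sigma$ is maximal monotone, i.e. $\mathrm{Re}\,\langle\sigma(u)-\sigma(v),u-v\rangle_U\ge0$ for all $u,v\in U$. Mild solutions: for $x_0\in X$, $d\in L^\infty_{\mathrm{loc}}(0,\infty;U)$ and $t_1>0$, a continuous $x:[0,t_1]\to X$ with $$x(t)=T(t)x_0-\int_0^tT(t-s)B\sigma\big(B^*x(s)+d(s)\big)\,ds,\quad t\in[0,t_1],$$ is a mild solution of $(\Sigma_{SLD})$ on $[0,t_1]$. It is called global if it is defined on $[0,\infty)$ and its restriction to each $[0,t_1]$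 is a mild solution. For given $x_0,d$ there is a unique mild solution on a maximal interval; ''the mild solution is global'' means this maximal interval is $[0,\infty)$. Comparison functions ($\mathbb{R}_+=[0,\infty)$): $\mathcal K$ is the set of continuous strictly increasing $\alpha:\mathbb{R}_+\to\mathbb{R}_+$ with $\alpha(0)=0$; $\mathcal K_\infty$ is the set of unbounded $\alpha\in\mathcal K$; $\mathcal L$ is the set of continuous strictly decreasing $\alpha:\mathbb{R}_+\to\mathbb{R}_+$ with $\lim_{t\to\infty}\alpha(t)=0$; $\mathcal{KL}$ is the set of continuous $\beta:\mathbb{R}_+\times\mathbb{R}_+\to\mathbb{R}_+$ with $\beta(\cdot,t)\in\mathcal K$ for all $t>0$ and $\beta(r,\cdot)\in\mathcal L$ for all $r>0$. ISS with respect to $C([0,\infty);U)$: there exist $\beta\in\mathcal{KL}$ and $\rho\in\mathcal K_\infty$ such that for every $x_0\in X$ and every continuous disturbance $d:[0,\infty)\to U$ the mild solution $x$ is global and $$\|x(t)\|_X\le\beta(\|x_0\|_X,t)+\rho(\|d\|_{L^\infty(0,t;U)})\quad\text{for all }t\ge0.$$ ISS Lyapunov function with respect to $C([0,\infty);U)$: a continuous function $V:X\to\mathbb{R}_{\ge0}$ for which there exist $\psi_1,\psi_2,\gamma,\rho\in\mathcal K_\infty$ such that for all $x_0\in X$ and all $d\in C([0,\infty);U)$ $$\psi_1(\|x_0\|_X)\le V(x_0)\le\psi_2(\|x_0\|_X)$$ and $$\dot V_d(x_0):=\limsup_{t\searrow0}\frac1t\big(V(x(t))-V(x_0)\big)\le-\gamma(\|x_0\|_X)+\rho(\|d\|_{L^\infty(0,\infty;U)}),$$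 where $x$ is the mild solution of $(\Sigma_{SLD})$ with initial value $x_0$ and disturbance $d$ (with the convention $\rho(\infty)=\infty$). *)

(* Defs.v *)
From Stdlib Require Import Reals.
From Coquelicot Require Import Coquelicot.
Open Scope R_scope.

Inductive scalars : Set := RealScalars | ComplexScalars.

Definition field_of (k : scalars) : AbsRing :=
  match k with RealScalars => R_AbsRing | ComplexScalars => C_AbsRing end.

Definition of_R (k : scalars) : R -> field_of k :=
  match k return R -> field_of k with
  | RealScalars => fun r => r
  | ComplexScalars => RtoC
  end.

Definition re_part (k : scalars) : field_of k -> R :=
  match k return field_of k -> R with
  | RealScalars => fun z => z
  | ComplexScalars => Re
  end.

Definition conj (k : scalars) : field_of k -> field_of k :=
  match k return field_of k -> field_of k with
  | RealScalars => fun z => z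
  | ComplexScalars => Cconj
  end.

Lemma of_R_mult (k : scalars) (x y : R) :
  of_R k (x * y) = mult (of_R k x) (of_R k y).
Proof. destruct k; [reflexivity | exact (RtoC_mult x y)]. Qed.

Lemma of_R_plus (k : scalars) (x y : R) :
  of_R k (x + y) = plus (of_R k x) (of_R k y).
Proof. destruct k; [reflexivity | exact (RtoC_plus x y)]. Qed.

Lemma of_R_one (k : scalars) : of_R k 1 = one.
Proof. destruct k; reflexivity. Qed.

Lemma abs_of_R (k : scalars) (x : R) : abs (of_R k x) = Rabs x.
Proof. destruct k; [reflexivity | exact (Cmod_R x)]. Qed.

(* Restriction of scalars to R, with the same carrier, topology and norm.  It is
   needed because Coquelicot integrates functions with values in real normed
   modules only. *)
Section Realify.

Context {k : scalars}.
Variable V : CompleteNormedModule (field_of k).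

Definition realify_ModuleSpace_mixin : ModuleSpace.mixin_of R_Ring V.
Proof.
refine (ModuleSpace.Mixin R_Ring V (fun (r : R) (v : V) => scal (of_R k r) v)
          _ _ _ _).
- intros x y u. rewrite scal_assoc. f_equal. symmetry. apply of_R_mult.
- intros u. change (scal (of_R k 1) u = u). rewrite of_R_one. apply scal_one.
- intros x u v. exact (scal_distr_l (of_R k x) (u : CompleteNormedModule.ModuleSpace _ V) v).
- intros x y u. change (plus x y) with (x + y). rewrite of_R_plus.
  exact (scal_distr_r (of_R k x) (of_R k y) (u : CompleteNormedModule.ModuleSpace _ V)).
Defined.

Definition realify_NormedModuleAux_class : NormedModuleAux.class_of R_AbsRing V :=
  NormedModuleAux.Class R_AbsRing V
    (ModuleSpace.Class R_Ring V
       (AbelianGroup.class (CompleteNormedModule.AbelianGroup _ V))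
       realify_ModuleSpace_mixin)
    (UniformSpace.class (CompleteNormedModule.UniformSpace _ V)).

Definition realify_NormedModule_mixin :
  NormedModule.mixin_of R_AbsRing
    (NormedModuleAux.Pack R_AbsRing V realify_NormedModuleAux_class V).
Proof.
refine (NormedModule.Mixin R_AbsRing
  (NormedModuleAux.Pack R_AbsRing V realify_NormedModuleAux_class V)
  (fun v : V => norm v) (@norm_factor _ (CompleteNormedModule.NormedModule _ V)) _ _ _ _ _).
- exact (@norm_triangle _ (CompleteNormedModule.NormedModule _ V)).
- intros l x. change (norm (scal (of_R k l) x : V) <= Rabs l * norm (x : V)).
  rewrite <- (abs_of_R k l). exact (norm_scal (V := CompleteNormedModule.NormedModule _ V) (of_R k l) x).
- exact (@norm_compat1 _ (CompleteNormedModule.NormedModule _ V)).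
- exact (@norm_compat2 _ (CompleteNormedModule.NormedModule _ V)).
- exact (@norm_eq_zero _ (CompleteNormedModule.NormedModule _ V)).
Defined.

Definition realify : CompleteNormedModule R_AbsRing :=
  CompleteNormedModule.Pack R_AbsRing V
    (CompleteNormedModule.Class R_AbsRing V
       (NormedModule.Class R_AbsRing V
          realify_NormedModuleAux_class realify_NormedModule_mixin)
       (CompleteNormedModule.mixin _ _ (CompleteNormedModule.class _ V)))
    V.

End Realify.

(* The inner product is linear in its first argument; definiteness follows from
   [inner_norm] and the definiteness of the norm. *)
Record HilbertSpace (k : scalars) : Type := mkHilbertSpace {
  hilbert_carrier :> CompleteNormedModule (field_of k);
  inner : hilbert_carrier -> hilbert_carrier -> field_of k;
  inner_plus_l : forall x y z, inner (plus x y) z = plus (inner x z) (inner y z);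
  inner_scal_l : forall a x y, inner (scal a x) y = mult a (inner x y);
  inner_conj : forall x y, inner y x = conj k (inner x y);
  inner_norm : forall x, inner x x = of_R k (norm x ^ 2)
}.

Arguments inner {k} h _ _.

Definition is_adjoint {k : scalars} {X U : HilbertSpace k}
  (B : U -> X) (Bs : X -> U) : Prop :=
  forall (u : U) (x : X), inner X (B u) x = inner U u (Bs x).

Definition op_norm {K : AbsRing} {V W : NormedModule K} (L : V -> W) : Rbar :=
  Lub_Rbar (fun r => exists v : V, norm v <= 1 /\ r = norm (L v)).

(* Only the values [T t] with [0 <= t] are meaningful. *)
Record is_C0_semigroup {k : scalars} {X : HilbertSpace k} (T : R -> X -> X) : Prop := {
  C0_linear : forall t, 0 <= t -> is_linear (T t);
  C0_zero : forall x, T 0 x = x;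
  C0_plus : forall s t x, 0 <= s -> 0 <= t -> T (s + t) x = T s (T t x);
  C0_cont : forall x, filterlim (fun t => T t x) (at_right 0) (locally x)
}.

Definition is_contraction_semigroup {k : scalars} {X : HilbertSpace k}
  (T : R -> X -> X) : Prop :=
  is_C0_semigroup T /\ forall t, 0 <= t -> Rbar_le (op_norm (T t)) 1.

Definition diff_quotient {k : scalars} {X : HilbertSpace k}
  (T : R -> X -> X) (x : X) (h : R) : X :=
  scal (of_R k (/ h)) (minus (T h x) x).

(* The generator is a partial operator: [A] is meaningful on its domain [D] only. *)
Definition is_generator {k : scalars} {X : HilbertSpace k}
  (T : R -> X -> X) (D : X -> Prop) (A : X -> X) : Prop :=
  (forall x, D x <->
     exists y : X, filterlim (diff_quotient T x) (at_right 0) (locally y)) /\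
  (forall x, D x -> filterlim (diff_quotient T x) (at_right 0) (locally (A x))).

Definition admissible_feedback {k : scalars} {U : HilbertSpace k}
  (sigma : U -> U) : Prop :=
  sigma zero = zero /\
  (forall r, 0 < r -> exists kr, 0 < kr /\
     forall u v : U, norm u <= r -> norm v <= r ->
       norm (minus (sigma u) (sigma v)) <= kr * norm (minus u v)) /\
  (forall u v : U,
     0 <= re_part k (inner U (minus (sigma u) (sigma v)) (minus u v))).

Definition continuous_disturbance {k : scalars} {U : HilbertSpace k}
  (d : R -> U) : Prop :=
  continuous_on (fun t => 0 <= t) d.

(* The vector-valued integral is the Riemann integral: for continuous [x] and [d]
   the integrand is continuous on [0, t]. *)
Definition mild_solution_on {k : scalars} {X U : HilbertSpace k}
  (T : R -> X -> X) (B : U -> X) (Bs : X -> U) (sigma : U -> U)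
  (x0 : X) (d : R -> U) (t1 : R) (x : R -> X) : Prop :=
  continuous_on (fun t => 0 <= t <= t1) x /\
  forall t, 0 <= t <= t1 ->
    let integrand := fun s => T (t - s) (B (sigma (plus (Bs (x s)) (d s)))) in
    ex_RInt (V := realify X) integrand 0 t /\
    x t = minus (T t x0) (RInt (V := realify X) integrand 0 t).

(* [x], restricted to [0, tmax), is the unique mild solution on the maximal
   interval of existence; it is global when [tmax = p_infty]. *)
Definition maximal_mild_solution {k : scalars} {X U : HilbertSpace k}
  (T : R -> X -> X) (B : U -> X) (Bs : X -> U) (sigma : U -> U)
  (x0 : X) (d : R -> U) (tmax : Rbar) (x : R -> X) : Prop :=
  Rbar_lt 0 tmax /\
  (forall t1, 0 < t1 -> Rbar_lt t1 tmax ->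
     mild_solution_on T B Bs sigma x0 d t1 x) /\
  (forall t1 y, 0 < t1 -> mild_solution_on T B Bs sigma x0 d t1 y ->
     Rbar_lt t1 tmax /\ forall t, 0 <= t <= t1 -> y t = x t).

Definition null_set (E : R -> Prop) : Prop :=
  forall eps, 0 < eps ->
    exists a b : nat -> R,
      (forall n, a n <= b n) /\
      (forall s, E s -> exists n, a n < s < b n) /\
      (forall n, sum_n (fun i => b i - a i) n <= eps).

(* Essential supremum of the norm of [d] over the interval (0, t). *)
Definition Linf_norm {k : scalars} {U : HilbertSpace k} (d : R -> U) (t : Rbar) : Rbar :=
  Glb_Rbar (fun M => 0 <= M /\
    null_set (fun s => 0 < s /\ Rbar_lt s t /\ M < norm (d s))).

(* Comparison functions are total on R and only considered on [0, +oo). *)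
Definition class_K (alpha : R -> R) : Prop :=
  (forall r, 0 <= r -> 0 <= alpha r) /\
  continuous_on (fun r => 0 <= r) alpha /\
  (forall r s, 0 <= r -> r < s -> alpha r < alpha s) /\
  alpha 0 = 0.

Definition class_Kinf (alpha : R -> R) : Prop :=
  class_K alpha /\ forall M, exists r, 0 <= r /\ M < alpha r.

Definition class_L (alpha : R -> R) : Prop :=
  (forall t, 0 <= t -> 0 <= alpha t) /\
  continuous_on (fun t => 0 <= t) alpha /\
  (forall s t, 0 <= s -> s < t -> alpha t < alpha s) /\
  is_lim alpha p_infty 0.

Definition class_KL (beta : R -> R -> R) : Prop :=
  (forall r t, 0 <= r -> 0 <= t -> 0 <= beta r t) /\
  continuous_on (fun p : R * R => 0 <= fst p /\ 0 <= snd p)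
    (fun p : R * R => beta (fst p) (snd p)) /\
  (forall t, 0 < t -> class_K (fun r => beta r t)) /\
  (forall r, 0 < r -> class_L (fun t => beta r t)).

(* Extension of a comparison function by [rho(+oo) = +oo]. *)
Definition Rbar_ext (rho : R -> R) (r : Rbar) : Rbar :=
  match r with Finite s => Finite (rho s) | _ => r end.

Definition limsup_right0 (f : R -> R) : Rbar :=
  Rbar_glb (fun l => exists delta, 0 < delta /\
    l = Lub_Rbar (fun r => exists t, 0 < t < delta /\ r = f t)).

Definition ISS_continuous {k : scalars} {X U : HilbertSpace k}
  (T : R -> X -> X) (B : U -> X) (Bs : X -> U) (sigma : U -> U) : Prop :=
  exists beta rho, class_KL beta /\ class_Kinf rho /\
    forall (x0 : X) (d : R -> U), continuous_disturbance d ->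
      exists x, maximal_mild_solution T B Bs sigma x0 d p_infty x /\
        forall t, 0 <= t ->
          Rbar_le (norm (x t))
            (Rbar_plus (beta (norm x0) t) (Rbar_ext rho (Linf_norm d t))).

Definition ISS_Lyapunov_continuous {k : scalars} {X U : HilbertSpace k}
  (T : R -> X -> X) (B : U -> X) (Bs : X -> U) (sigma : U -> U)
  (V : X -> R) : Prop :=
  (forall x, 0 <= V x) /\
  (forall x, continuous V x) /\
  exists psi1 psi2 gamma rho,
    class_Kinf psi1 /\ class_Kinf psi2 /\ class_Kinf gamma /\ class_Kinf rho /\
    forall (x0 : X) (d : R -> U), continuous_disturbance d ->
      psi1 (norm x0) <= V x0 <= psi2 (norm x0) /\
      exists tmax x, maximal_mild_solution T B Bs sigma x0 d tmax x /\
        Rbar_le (limsup_right0 (fun t => / t * (V (x t) - V x0)))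
          (Rbar_plus (- gamma (norm x0)) (Rbar_ext rho (Linf_norm d p_infty))).

(* Main.v *)
(** A mild solution satisfies
    [x (t + h) = T h (x t - h B sigma (Bs (x t) + d t)) + o(h)], so
    [norm (T h) <= exp (- alpha h)] bounds the upper right Dini derivative of
    [norm (x t) ^ 2] by [- 2 alpha norm (x t) ^ 2 - 2 Re <sigma (Bs x + d), Bs x>],
    without any differentiability of [x]. Monotonicity of [sigma] gives
    [Re <sigma (Bs x + d), Bs x> >= Re <sigma d, Bs x>], and Young's inequality
    turns this into [- alpha norm (x t) ^ 2 + C norm (sigma (d t)) ^ 2]; both
    assertions follow. The same Dini estimate for the difference of two solutions
    gives uniqueness. For existence, [sigma] is precomposed with the radial
    retraction onto a ball, which makes it globally Lipschitz, so that Picard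
    iteration applies; the a priori bound survives the truncation (up to a factor
    2) and does not depend on the radius, so a large ball is never left. *)

Require Import Defs.
From Stdlib Require Import Reals Lra Lia Psatz Classical.
From Coquelicot Require Import Coquelicot.
Open Scope R_scope.

(** * Real and vector-valued functions of a real variable *)

(** The estimates live in real Hilbert spaces: after restriction of scalars, the real part of the
    inner product is a real inner product with the same norm, and it is all that monotonicity and
    the energy balance see. They are stated for [x' = A x - f] with an arbitrary continuous forcing
    [f]; the feedback enters only through a bound on the pairing of [x] with [f]. The obstacle is
    circularity: [sigma] is Lipschitz on balls with uncontrolled constants, so the truncation radius
    has to be chosen from an a priori bound that is itself proved for the truncated system.
    Monotonicity, tested against [d] and against [0], gives a bound in which no Lipschitz constant
    of [sigma] appears; the factor 2 is the Lipschitz constant of the retraction. The gain is built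
    from the supremum of [norm (sigma u)] over balls. This is continuous and nondecreasing, but
    possibly bounded or locally constant, so the identity is added to reach class K-infinity. As
    disturbances are measured by an essential supremum, pointwise bounds on [d] require that a
    nondegenerate interval is not a null set. *)

Lemma interval_induction (P : R -> Prop) (a b : R) :
  (forall t, a <= t <= b -> (forall s, a <= s < t -> P s) ->
     exists delta, 0 < delta /\ forall s, t <= s < t + delta -> s <= b -> P s) ->
  forall t, a <= t <= b -> P t.
Proof.
intros step t ht.
(* Half-open segments put [a] into [E] for free, and the supremum [m] inherits the property. The
   step at [m] then covers [t] or yields a member of [E] beyond [m]. *)
set (E := fun c => a <= c <= b /\ forall s, a <= s < c -> P s).
destruct (completeness E) as [m [hub hlub]].
- exists b. intros c [hc _]. lra.
- exists a. split; [lra | intros s hs; lra].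
- assert (hbelow : forall s, a <= s < m -> P s).
  { intros s hs. apply NNPP. intros hn.
    assert (hm : m <= s).
    { apply hlub. intros c [hc hP]. apply Rnot_lt_le. intros hsc.
      apply hn, hP. lra. }
    lra. }
  assert (ham : a <= m) by (apply hub; split; [lra | intros s hs; lra]).
  assert (hmb : m <= b) by (apply hlub; intros c [hc _]; lra).
  destruct (step m (Logic.conj ham hmb) hbelow) as [delta [hdelta hP]].
  destruct (Rlt_le_dec t (m + delta)) as [htd | htd].
  + destruct (Rlt_le_dec t m) as [htm | htm]; [apply hbelow | apply hP]; lra.
  + assert (hE : E (m + delta / 2)).
    { split; [lra |]. intros s hs.
      destruct (Rlt_le_dec s m); [apply hbelow | apply hP]; lra. }
    specialize (hub _ hE). lra.
Qed.

Lemma continuous_norm_iff {V : CompleteNormedModule R_AbsRing} (f : R -> V) (t : R) :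
  continuous f t <->
  forall eps, 0 < eps -> exists delta, 0 < delta /\
    forall s, Rabs (s - t) < delta -> norm (minus (f s) (f t)) < eps.
Proof.
unfold continuous.
rewrite (filterlim_locally_ball_norm (F := locally t) f (f t)). split.
- intros h eps heps. destruct (h (mkposreal eps heps)) as [delta hd].
  exists delta. split; [apply cond_pos |]. intros s hs. exact (hd s hs).
- intros h eps. destruct (h eps (cond_pos eps)) as [delta [hdelta hd]].
  exists (mkposreal delta hdelta). intros s hs. exact (hd s hs).
Qed.

Lemma filterlim_within_norm_iff {V : CompleteNormedModule R_AbsRing}
  (D : R -> Prop) (f : R -> V) (t : R) (y : V) :
  filterlim f (within D (locally t)) (locally y) <->
  forall eps, 0 < eps -> exists delta, 0 < delta /\
    forall s, Rabs (s - t) < delta -> D s -> norm (minus (f s) y) < eps.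
Proof.
rewrite (filterlim_locally_ball_norm (F := within D (locally t)) f y). split.
- intros h eps heps. destruct (h (mkposreal eps heps)) as [delta hd].
  exists delta. split; [apply cond_pos |]. intros s hs. exact (hd s hs).
- intros h eps. destruct (h eps (cond_pos eps)) as [delta [hdelta hd]].
  exists (mkposreal delta hdelta). intros s hs. exact (hd s hs).
Qed.

(** Used with [p] a retraction of the line onto [[0, t1]] or [[0, +oo)]: relative continuity becomes
    continuity everywhere, the only kind the integral lemmas below have to handle. *)
Lemma continuous_on_comp_nonexpansive {V : CompleteNormedModule R_AbsRing}
  (D : R -> Prop) (x : R -> V) (p : R -> R) :
  continuous_on D x -> (forall t, D (p t)) ->
  (forall s t, Rabs (p s - p t) <= Rabs (s - t)) ->
  forall t, continuous (fun s => x (p s)) t.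
Proof.
intros hx hpD hp t. apply continuous_norm_iff. intros eps heps.
destruct (proj1 (filterlim_within_norm_iff D x (p t) (x (p t))) (hx _ (hpD t)) eps heps)
  as [delta [hdelta hd]].
exists delta. split; [exact hdelta |]. intros s hs. apply hd; [| apply hpD].
apply Rle_lt_trans with (1 := hp s t), hs.
Qed.

Definition clamp (t1 t : R) : R := Rmax 0 (Rmin t t1).

Lemma clamp_range (t1 t : R) : 0 <= t1 -> 0 <= clamp t1 t <= t1.
Proof. unfold clamp, Rmax, Rmin; repeat destruct Rle_dec; lra. Qed.

Lemma clamp_id (t1 t : R) : 0 <= t <= t1 -> clamp t1 t = t.
Proof. unfold clamp, Rmax, Rmin; repeat destruct Rle_dec; lra. Qed.

Lemma clamp_nonexpansive (t1 s t : R) : Rabs (clamp t1 s - clamp t1 t) <= Rabs (s - t).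
Proof.
unfold clamp, Rmax, Rmin, Rabs.
repeat destruct Rle_dec; repeat destruct Rcase_abs; lra.
Qed.

Lemma Rmax_0_nonexpansive (s t : R) : Rabs (Rmax 0 s - Rmax 0 t) <= Rabs (s - t).
Proof. unfold Rmax, Rabs. repeat destruct Rle_dec; repeat destruct Rcase_abs; lra. Qed.

Lemma is_RInt_apply {V W : CompleteNormedModule R_AbsRing} (L : V -> W) (f : R -> V)
  (a b : R) (l : V) :
  is_linear L -> is_RInt f a b l -> is_RInt (fun s => L (f s)) a b (L l).
Proof.
intros hL hf. unfold is_RInt.
apply filterlim_ext with
  (fun ptd : SF_seq => L (scal (sign (b - a)) (Riemann_sum f ptd))).
- intros ptd. rewrite (linear_scal _ hL). f_equal.
  induction ptd as [x0 | h ptd IH] using SF_cons_ind.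
  + exact (linear_zero L hL).
  + rewrite !Riemann_sum_cons, (linear_plus _ hL), (linear_scal _ hL), IH.
    reflexivity.
- exact (filterlim_comp _ _ _ _ _ _ _ _ hf (linear_cont L l hL)).
Qed.

(** With the margin [eta] added, the claimed bound [phi] is a strict supersolution of
    [v' = - a v + K]. So [v] cannot cross it: below [phi] continuity suffices, and where they touch
    the Dini bound keeps [v] under [phi] for a short time. *)
Lemma dini_decay (v : R -> R) (t1 a K : R) :
  0 < a -> 0 <= K -> 0 <= v 0 ->
  (forall t eps, 0 <= t -> 0 < eps -> exists delta, 0 < delta /\
     forall s, 0 <= s -> Rabs (s - t) < delta -> Rabs (v s - v t) < eps) ->
  (forall t eps, 0 <= t < t1 -> 0 < eps -> exists delta, 0 < delta /\
     forall h, 0 < h < delta -> v (t + h) <= v t + h * (- a * v t + K + eps)) ->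
  forall t, 0 <= t <= t1 -> v t <= exp (- a * t) * v 0 + K / a.
Proof.
intros ha hK hv0 hcont hdini t ht.
apply le_epsilon. intros eta heta.
assert (hKa : 0 <= K / a) by (apply Rdiv_le_0_compat; assumption).
set (phi := fun s => exp (- a * s) * v 0 + K / a + eta).
assert (hphi : forall s eps, 0 < eps -> exists delta, 0 < delta /\
          forall r, Rabs (r - s) < delta -> Rabs (phi r - phi s) < eps).
{ intros s. apply (continuous_norm_iff (V := R_CompleteNormedModule) phi s).
  apply (ex_derive_continuous phi s). unfold phi. auto_derive. exact I. }
apply (interval_induction (fun s => v s <= phi s) 0 t1); [| exact ht].
clear t ht. intros t ht IH.
assert (htouch : v t <= phi t).
{ apply Rnot_lt_le. intros hgt.
  destruct (hcont t ((v t - phi t) / 2)) as [d1 [hd1 h1]]; [lra | lra |].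
  destruct (hphi t ((v t - phi t) / 2)) as [d2 [hd2 h2]]; [lra |].
  destruct (Req_dec t 0) as [-> | ht0].
  - unfold phi in hgt. rewrite Rmult_0_r, exp_0 in hgt. lra.
  - set (s := Rmax 0 (t - Rmin d1 d2 / 2)).
    assert (hs : 0 <= s < t /\ Rabs (s - t) < d1 /\ Rabs (s - t) < d2).
    { unfold s, Rmax, Rmin, Rabs.
      repeat destruct Rle_dec; repeat destruct Rcase_abs; lra. }
    destruct hs as [hs [hsd1 hsd2]].
    specialize (h1 s (proj1 hs) hsd1). specialize (h2 s hsd2). specialize (IH s hs).
    apply Rabs_def2 in h1. apply Rabs_def2 in h2. lra. }
destruct (Rle_lt_or_eq_dec _ _ htouch) as [hlt | heq].
- destruct (hcont t ((phi t - v t) / 2)) as [d1 [hd1 h1]]; [lra | lra |].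
  destruct (hphi t ((phi t - v t) / 2)) as [d2 [hd2 h2]]; [lra |].
  exists (Rmin d1 d2). split; [apply Rmin_glb_lt; assumption |].
  intros s hs _.
  assert (hsd : Rabs (s - t) < d1 /\ Rabs (s - t) < d2).
  { destruct hs as [hs0 hs]. rewrite Rabs_pos_eq by lra.
    split; apply Rlt_le_trans with (Rmin d1 d2); try lra; [apply Rmin_l | apply Rmin_r]. }
  specialize (h1 s ltac:(lra) (proj1 hsd)). specialize (h2 s (proj2 hsd)).
  apply Rabs_def2 in h1. apply Rabs_def2 in h2. lra.
- destruct (Rlt_le_dec t t1) as [htt1 | htt1].
  (* The error [a * eta] is exactly the strictness of [phi]: at a touching point the slope becomes
     [- a * exp (- a * t) * v 0], the derivative of [phi]. *)
  + destruct (hdini t (a * eta)) as [d [hd h]]; [lra | nra |].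
    exists d. split; [exact hd |]. intros s hs _.
    destruct (Req_dec s t) as [-> | hst]; [exact htouch |].
    specialize (h (s - t) ltac:(lra)).
    replace (t + (s - t)) with s in h by ring.
    apply Rle_trans with (1 := h). rewrite heq.
    assert (hexp : exp (- a * t) * (1 - a * (s - t)) <= exp (- a * s)).
    { replace (- a * s) with (- a * t + - (a * (s - t))) by ring.
      rewrite exp_plus. apply Rmult_le_compat_l; [left; apply exp_pos |].
      pose proof (exp_ineq1_le (- (a * (s - t)))). lra. }
    apply (Rmult_le_compat_r (v 0) _ _ hv0) in hexp.
    replace (phi t + (s - t) * (- a * phi t + K + a * eta)) with
      (exp (- a * t) * (1 - a * (s - t)) * v 0 + K / a + eta)
      by (unfold phi; field; lra).
    unfold phi. lra.
  + exists 1. split; [lra |]. intros s hs hs1.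
    replace s with t by lra. exact htouch.
Qed.

Lemma norm_minus_eq_zero {V : CompleteNormedModule R_AbsRing} (x y : V) :
  norm (minus x y) = 0 -> x = y.
Proof.
intros h. apply (plus_reg_r (opp y)). rewrite plus_opp_r.
exact (norm_eq_zero (V := V) _ h).
Qed.

Lemma norm_minus_diag {V : CompleteNormedModule R_AbsRing} (x : V) :
  norm (minus x x) = 0.
Proof.
assert (h : minus x x = zero) by exact (minus_eq_zero x).
rewrite h. exact (norm_zero (V := V)).
Qed.

Lemma norm_plus_le {V : CompleteNormedModule R_AbsRing} (x y : V) :
  norm (plus x y) <= norm x + norm y.
Proof. exact (norm_triangle (V := V) x y). Qed.

Lemma norm_opp_eq {V : CompleteNormedModule R_AbsRing} (x : V) : norm (opp x) = norm x.
Proof. exact (norm_opp (V := V) x). Qed.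

Lemma norm_minus_triangle {V : CompleteNormedModule R_AbsRing} (x y z : V) :
  norm (minus x z) <= norm (minus x y) + norm (minus y z).
Proof.
assert (h : minus x z = plus (minus x y) (minus y z)) by exact (minus_trans y x z).
rewrite h. apply norm_plus_le.
Qed.

Lemma norm_minus_sym {V : CompleteNormedModule R_AbsRing} (x y : V) :
  norm (minus x y) = norm (minus y x).
Proof.
assert (h : minus y x = opp (minus x y)) by (symmetry; exact (opp_minus x y)).
rewrite h, norm_opp_eq. reflexivity.
Qed.

(** * Real inner products *)

(** A predicate on a bare function, so that the real part of a complex inner product qualifies on
    the space with restricted scalars. *)
Record is_inner {V : CompleteNormedModule R_AbsRing} (ip : V -> V -> R) : Prop := {
  ip_plus_l : forall x y z, ip (plus x y) z = ip x z + ip y z;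
  ip_scal_l : forall a x y, ip (scal a x) y = a * ip x y;
  ip_sym : forall x y, ip x y = ip y x;
  ip_norm : forall x, ip x x = norm x ^ 2
}.

Section InnerProduct.

Context {V : CompleteNormedModule R_AbsRing} {ip : V -> V -> R} (hip : is_inner ip).

Lemma ip_opp_l (x y : V) : ip (opp x) y = - ip x y.
Proof.
assert (h : opp x = scal (- (1)) x) by (symmetry; exact (scal_opp_one x)).
rewrite h, (ip_scal_l _ hip). ring.
Qed.

Lemma ip_zero_l (y : V) : ip zero y = 0.
Proof.
assert (h : (zero : V) = scal 0 y) by (symmetry; exact (scal_zero_l y)).
rewrite h, (ip_scal_l _ hip). ring.
Qed.

Lemma ip_minus_l (x y z : V) : ip (minus x y) z = ip x z - ip y z.
Proof. unfold minus. rewrite (ip_plus_l _ hip), ip_opp_l. ring. Qed.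

Lemma ip_ext (x y : V) : (forall z, ip x z = ip y z) -> x = y.
Proof.
intros h. apply norm_minus_eq_zero.
assert (hz : norm (minus x y) ^ 2 = 0).
{ rewrite <- (ip_norm _ hip), ip_minus_l, h. ring. }
apply Rsqr_0_uniq. rewrite Rsqr_pow2. exact hz.
Qed.

End InnerProduct.

Ltac expand_ip h :=
  repeat first
    [ rewrite (ip_minus_l h) | rewrite (ip_opp_l h) | rewrite (ip_zero_l h)
    | rewrite (ip_plus_l _ h) | rewrite (ip_scal_l _ h) ].

(* Proves linear identities by taking inner products with an arbitrary vector. *)
Ltac vec_eq h :=
  apply (ip_ext h); let z := fresh "z" in intros z; expand_ip h;
  try ring.

Section InnerProductTheory.

Context {V : CompleteNormedModule R_AbsRing} {ip : V -> V -> R} (hip : is_inner ip).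

(** The norm axioms give one inequality; equality comes from the inner product. *)
Lemma norm_scal_R (r : R) (x : V) : norm (scal r x) = Rabs r * norm x.
Proof.
apply Rsqr_inj; [apply norm_ge_0 | |].
- apply Rmult_le_pos; [apply Rabs_pos | apply norm_ge_0].
- rewrite !Rsqr_pow2, <- (ip_norm _ hip), (ip_scal_l _ hip), (ip_sym _ hip).
  rewrite (ip_scal_l _ hip), (ip_norm _ hip), Rpow_mult_distr, pow2_abs. ring.
Qed.

Lemma norm_plus_sq (x y : V) :
  norm (plus x y) ^ 2 = norm x ^ 2 + 2 * ip x y + norm y ^ 2.
Proof.
rewrite <- !(ip_norm _ hip). expand_ip hip.
rewrite (ip_sym _ hip x (plus x y)), (ip_sym _ hip y (plus x y)). expand_ip hip.
rewrite (ip_sym _ hip y x). ring.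
Qed.

Lemma cauchy_schwarz (x y : V) : Rabs (ip x y) <= norm x * norm y.
Proof.
assert (hq : forall r, 0 <= norm x ^ 2 + 2 * r * ip x y + r ^ 2 * norm y ^ 2).
{ intros r. replace (norm x ^ 2 + 2 * r * ip x y + r ^ 2 * norm y ^ 2)
    with (norm (plus x (scal r y)) ^ 2); [apply pow2_ge_0 |].
  rewrite norm_plus_sq, (ip_sym _ hip), (ip_scal_l _ hip), (ip_sym _ hip y x).
  rewrite norm_scal_R, Rpow_mult_distr, pow2_abs. ring. }
pose proof (norm_ge_0 x) as hx. pose proof (norm_ge_0 y) as hy.
assert (hsq : ip x y ^ 2 <= (norm x * norm y) ^ 2).
{ destruct (Req_dec (norm y) 0) as [hy0 | hy0].
  - assert (y = zero) as -> by (apply (norm_eq_zero (V := V)); exact hy0).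
    rewrite (ip_sym _ hip), (ip_zero_l hip). nra.
  - specialize (hq (- ip x y / norm y ^ 2)).
    assert (hy2 : 0 < norm y ^ 2) by (apply pow2_gt_0; exact hy0).
    apply (Rmult_le_compat_r (norm y ^ 2)) in hq; [| lra].
    field_simplify in hq; [| exact hy0]. nra. }
rewrite <- (Rabs_pos_eq (norm x * norm y)) by nra.
apply Rsqr_le_abs_0. rewrite !Rsqr_pow2. exact hsq.
Qed.

End InnerProductTheory.

(** * Geometrically convergent sequences *)

Lemma exp_le_compat (x y : R) : x <= y -> exp x <= exp y.
Proof.
intros [h | ->]; [left; apply exp_increasing, h | right; reflexivity].
Qed.

Lemma div_pow2_small (D eps : R) : 0 < eps -> exists n, D / 2 ^ n < eps.
Proof.
intros heps.
destruct (Pow_x_infinity 2 ltac:(rewrite Rabs_pos_eq; lra) ((Rabs D + 1) / eps)) as [n hn].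
exists n. specialize (hn n (le_n n)).
assert (hpow : 0 < 2 ^ n) by (apply pow_lt; lra).
rewrite Rabs_pos_eq in hn by lra.
apply Rlt_div_l; [exact hpow |].
apply Rge_le, Rle_div_l in hn; [| exact heps].
pose proof (Rle_abs D). lra.
Qed.

Lemma geometric_cauchy_limit {V : CompleteNormedModule R_AbsRing} (u : nat -> V) (c : R) :
  (forall n, norm (minus (u (S n)) (u n)) <= c / 2 ^ n) ->
  exists l, filterlim u eventually (locally l) /\
    forall n, norm (minus l (u n)) <= 2 * c / 2 ^ n.
Proof.
intros hu.
assert (hpow : forall n, 0 < 2 ^ n) by (intros n; apply pow_lt; lra).
assert (hc : 0 <= c).
{ apply Rle_trans with (1 := norm_ge_0 (minus (u 1%nat) (u 0%nat))).
  apply Rle_trans with (1 := hu 0%nat). simpl. lra. }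
assert (htail : forall n k, norm (minus (u (n + k)%nat) (u n)) <= 2 * c / 2 ^ n).
{ intros n k.
  (* Subtracting the remaining tail makes the induction on [k] telescope. *)
  apply Rle_trans with (2 * c / 2 ^ n - 2 * c / 2 ^ (n + k)).
  - induction k as [| k IH].
    + rewrite Nat.add_0_r, norm_minus_diag. lra.
    + apply Rle_trans with (1 := norm_minus_triangle _ (u (n + k)%nat) _).
      specialize (hu (n + k)%nat). rewrite Nat.add_succ_r.
      replace (2 * c / 2 ^ S (n + k)) with (c / 2 ^ (n + k))
        by (simpl; field; apply Rgt_not_eq, hpow).
      lra.
  - assert (0 <= 2 * c / 2 ^ (n + k)) by (apply Rdiv_le_0_compat; [lra | apply hpow]). lra. }
destruct (proj1 (filterlim_locally_cauchy (F := eventually) u)) as [l hl].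
{ intros eps. destruct (div_pow2_small (4 * c) eps (cond_pos eps)) as [n hn].
  exists (fun m => (n <= m)%nat). split; [exists n; intros m hm; exact hm |].
  intros p q hp hq. apply (norm_compat1 (V := V)).
  apply Rle_lt_trans with (1 := norm_minus_triangle _ (u n) _).
  rewrite (norm_minus_sym (u n)).
  pose proof (htail n (p - n)%nat) as h1. pose proof (htail n (q - n)%nat) as h2.
  replace (n + (p - n))%nat with p in h1 by lia.
  replace (n + (q - n))%nat with q in h2 by lia.
  replace (4 * c / 2 ^ n) with (2 * c / 2 ^ n + 2 * c / 2 ^ n) in hn
    by (field; apply Rgt_not_eq, hpow).
  lra. }
exists l. split; [exact hl |]. intros n.
apply le_epsilon. intros eps heps.
destruct (proj1 (filterlim_locally_ball_norm (F := eventually) (U := V) u l) hl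
            (mkposreal eps heps)) as [m hm].
specialize (hm (n + m)%nat ltac:(lia)). unfold ball_norm in hm. simpl in hm.
apply Rle_trans with (1 := norm_minus_triangle _ (u (n + m)%nat) _).
rewrite (norm_minus_sym l). specialize (htail n m).
apply Rle_trans with (eps + 2 * c / 2 ^ n); [| lra].
apply Rplus_le_compat; [left; exact hm | exact htail].
Qed.

(** * Contraction semigroups and the variation-of-constants formula *)

(* Semigroups are extended by the identity to negative times, so that
   [s |-> S (t - s) (f s)] is continuous on all of [R]. *)
Record contraction_flow {V : CompleteNormedModule R_AbsRing}
  (alpha : R) (S : R -> V -> V) : Prop := {
  flow_linear : forall t, is_linear (S t);
  flow_neg : forall t x, t <= 0 -> S t x = x;
  flow_plus : forall s t x, 0 <= s -> 0 <= t -> S (s + t) x = S s (S t x);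
  flow_norm : forall t x, 0 <= t -> norm (S t x) <= exp (- alpha * t) * norm x;
  flow_cont : forall x eps, 0 < eps -> exists delta, 0 < delta /\
    forall h, 0 <= h < delta -> norm (minus (S h x) x) < eps
}.

Definition convolution {V : CompleteNormedModule R_AbsRing}
  (S : R -> V -> V) (f : R -> V) (t : R) : V :=
  RInt (fun s => S (t - s) (f s)) 0 t.

(** Variation of constants for [x' = A x - f], open loop: solving the feedback system means finding
    [x] that is its own trajectory for the forcing it generates. *)
Definition trajectory {V : CompleteNormedModule R_AbsRing}
  (S : R -> V -> V) (f : R -> V) (x0 : V) (t : R) : V :=
  minus (S t x0) (convolution S f t).

Section Flow.

Context {V : CompleteNormedModule R_AbsRing} {ip : V -> V -> R} (hip : is_inner ip).
Context {alpha : R} (halpha : 0 < alpha) {S : R -> V -> V}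
  (hS : contraction_flow alpha S).

Lemma flow_minus (t : R) (x y : V) : S t (minus x y) = minus (S t x) (S t y).
Proof.
transitivity (plus (S t x) (S t (opp y))).
- exact (linear_plus _ (flow_linear _ _ hS t) x (opp y)).
- unfold minus. f_equal. exact (linear_opp _ _ (flow_linear _ _ hS t)).
Qed.

Lemma flow_contract (t : R) (x : V) : norm (S t x) <= norm x.
Proof.
pose proof (norm_ge_0 x) as hx.
destruct (Rle_lt_dec t 0) as [ht | ht].
- rewrite (flow_neg _ _ hS) by exact ht. lra.
- apply Rle_trans with (1 := flow_norm _ _ hS t x (Rlt_le _ _ ht)).
  assert (exp (- alpha * t) <= 1).
  { rewrite <- exp_0. left. apply exp_increasing. nra. }
  nra.
Qed.

(** Factoring out the flow up to the smaller time, a contraction, reduces continuity at any pair of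
    times to continuity at time zero; [Rmax 0] accounts for negative times. *)
Lemma flow_dist (s t : R) (x y : V) :
  norm (minus (S s x) (S t y)) <=
  norm (minus x y) + norm (minus (S (Rabs (Rmax 0 s - Rmax 0 t)) y) y).
Proof.
assert (hmax : forall r z, S r z = S (Rmax 0 r) z).
{ intros r z. unfold Rmax. destruct Rle_dec; [reflexivity |].
  rewrite !(flow_neg _ _ hS) by lra. reflexivity. }
rewrite (hmax s), (hmax t).
generalize (Rmax_l 0 s), (Rmax_l 0 t). generalize (Rmax 0 s), (Rmax 0 t).
clear s t. intros s t hs ht.
apply Rle_trans with (norm (minus (S s x) (S s y)) + norm (minus (S s y) (S t y)));
  [apply norm_minus_triangle |].
rewrite <- flow_minus. apply Rplus_le_compat; [apply flow_contract |].
destruct (Rle_lt_dec s t) as [hst | hst].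
- replace t with (s + (t - s)) at 1 by ring.
  rewrite (flow_plus _ _ hS) by lra. rewrite norm_minus_sym, <- flow_minus.
  replace (Rabs (s - t)) with (t - s) by (rewrite Rabs_left1; lra).
  apply flow_contract.
- replace s with (t + (s - t)) at 1 by ring.
  rewrite (flow_plus _ _ hS) by lra. rewrite <- flow_minus.
  rewrite (Rabs_pos_eq (s - t)) by lra. apply flow_contract.
Qed.

(** Only the difference of the times [a], [b] matters, so one [delta] serves all of them, including
    times [t + h - s] that vary under an integral. *)
Lemma flow_dist_small (f : R -> V) (t : R) : continuous f t ->
  forall eps, 0 < eps -> exists delta, 0 < delta /\
    forall a b s, Rabs (s - t) < delta -> Rabs (a - b) < delta ->
      norm (minus (S a (f s)) (S b (f t))) < eps.
Proof.
intros hf eps heps.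
destruct (proj1 (continuous_norm_iff f t) hf (eps / 2)) as [d1 [hd1 h1]]; [lra |].
destruct (flow_cont _ _ hS (f t) (eps / 2)) as [d2 [hd2 h2]]; [lra |].
exists (Rmin d1 d2). split; [apply Rmin_glb_lt; assumption |].
intros a b s hs hab.
apply Rle_lt_trans with (1 := flow_dist a b (f s) (f t)).
assert (Rabs (Rmax 0 a - Rmax 0 b) < d2).
{ apply Rle_lt_trans with (Rabs (a - b)).
  - apply Rmax_0_nonexpansive.
  - apply Rlt_le_trans with (1 := hab), Rmin_r. }
assert (norm (minus (f s) (f t)) < eps / 2)
  by (apply h1, Rlt_le_trans with (1 := hs), Rmin_l).
assert (norm (minus (S (Rabs (Rmax 0 a - Rmax 0 b)) (f t)) (f t)) < eps / 2)
  by (apply h2; split; [apply Rabs_pos | assumption]).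
lra.
Qed.

Section Convolution.

Context {f : R -> V} (hf : forall t, continuous f t).

Lemma convolution_integrand_continuous (t s : R) :
  continuous (fun r => S (t - r) (f r)) s.
Proof.
apply continuous_norm_iff. intros eps heps.
destruct (flow_dist_small f s (hf s) eps heps) as [d [hd h]].
exists d. split; [exact hd |]. intros r hr. apply h; [exact hr |].
replace (t - r - (t - s)) with (- (r - s)) by ring. rewrite Rabs_Ropp. exact hr.
Qed.

Lemma ex_RInt_convolution (t a b : R) : ex_RInt (fun s => S (t - s) (f s)) a b.
Proof.
apply (ex_RInt_continuous (V := V)). intros z _. apply convolution_integrand_continuous.
Qed.

Lemma convolution_shift (t h : R) : 0 <= t -> 0 <= h ->
  convolution S f (t + h) =
  plus (S h (convolution S f t)) (RInt (fun s => S (t + h - s) (f s)) t (t + h)).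
Proof.
intros ht hh. unfold convolution.
rewrite <- (RInt_Chasles _ 0 t (t + h)) by apply ex_RInt_convolution.
f_equal. apply is_RInt_unique.
apply is_RInt_ext with (fun s => S h (S (t - s) (f s))).
- intros s. rewrite Rmin_left, Rmax_right by lra. intros hs.
  rewrite <- (flow_plus _ _ hS) by lra. f_equal. ring.
- apply is_RInt_apply; [apply (flow_linear _ _ hS) |].
  apply (RInt_correct (V := V)), ex_RInt_convolution.
Qed.

Lemma norm_RInt_convolution_le (t a b M : R) : a <= b ->
  (forall s, a <= s <= b -> norm (f s) <= M) ->
  norm (RInt (fun s => S (t - s) (f s)) a b) <= (b - a) * M.
Proof.
intros hab hM.
apply (norm_RInt_le_const (fun s => S (t - s) (f s)) a b _ M hab).
- intros s hs. apply Rle_trans with (2 := hM s hs), flow_contract.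
- apply (RInt_correct (V := V)), ex_RInt_convolution.
Qed.

(** Strong continuity is uniform on the compact set [f [0, t1]]; interval induction takes the place
    of a finite subcover. *)
Lemma flow_uniformly_small (t1 eps : R) : 0 < eps ->
  exists delta, 0 < delta /\ forall h s, 0 <= h < delta -> 0 <= s <= t1 ->
    norm (minus (S h (f s)) (f s)) < eps.
Proof.
intros heps.
destruct (Rlt_le_dec t1 0) as [ht1 | ht1].
{ exists 1. split; [lra |]. intros; lra. }
apply (interval_induction (fun c => exists delta, 0 < delta /\
  forall h s, 0 <= h < delta -> 0 <= s <= c ->
    norm (minus (S h (f s)) (f s)) < eps) 0 t1); [| lra].
intros t ht IH.
destruct (flow_dist_small f t (hf t) (eps / 2)) as [d [hd hsm]]; [lra |].
assert (hloc : forall h s, 0 <= h < d -> Rabs (s - t) < d ->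
          norm (minus (S h (f s)) (f s)) < eps).
{ intros h s hh hs.
  apply Rle_lt_trans with (1 := norm_minus_triangle _ (S 0 (f t)) _).
  rewrite (norm_minus_sym _ (f s)).
  rewrite <- (flow_neg _ _ hS 0 (f s)) at 2 by lra.
  replace eps with (eps / 2 + eps / 2) by field.
  apply Rplus_lt_compat; apply hsm; try assumption;
    rewrite Rminus_0_r, Rabs_pos_eq || rewrite Rminus_0_r, Rabs_R0; lra. }
assert (hprev : exists d', 0 < d' /\ forall h s, 0 <= h < d' -> 0 <= s <= t - d / 2 ->
          norm (minus (S h (f s)) (f s)) < eps).
{ destruct (Rlt_le_dec (t - d / 2) 0) as [hn | hn].
  - exists 1. split; [lra |]. intros; lra.
  - apply IH. lra. }
destruct hprev as [d' [hd' hprev]].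
exists d. split; [exact hd |]. intros c hc _.
exists (Rmin d d'). split; [apply Rmin_glb_lt; assumption |].
intros h s [hh0 hh] hs.
assert (h < d) by (apply Rlt_le_trans with (1 := hh), Rmin_l).
assert (h < d') by (apply Rlt_le_trans with (1 := hh), Rmin_r).
destruct (Rle_lt_dec s (t - d / 2)).
- apply hprev; lra.
- apply hloc; [lra |]. apply Rabs_def1; lra.
Qed.

Lemma flow_commute (s t : R) (x : V) : 0 <= s -> 0 <= t -> S s (S t x) = S t (S s x).
Proof.
intros hs ht. rewrite <- !(flow_plus _ _ hS) by assumption. f_equal. ring.
Qed.

(** The increment splits into the integral over [[s, t]], of size [(t - s) * M], and [S (t - s) - 1]
    applied to the convolution at [s]. In the latter the flow commutes under the integral, so
    [S (t - s) - 1] acts directly on the values of [f], where it is uniformly small. *)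
Lemma convolution_modulus (t1 eps : R) : 0 <= t1 -> 0 < eps ->
  exists delta, 0 < delta /\ forall s t, 0 <= s -> s <= t -> t <= t1 -> t - s < delta ->
    norm (minus (convolution S f t) (convolution S f s)) < eps.
Proof.
intros ht1 heps.
destruct (bounded_continuity f 0 t1) as [M hM]; [intros x _; apply hf |].
assert (hMpos : 0 < M)
  by (apply Rle_lt_trans with (1 := norm_ge_0 (f 0)), hM; lra).
destruct (flow_uniformly_small t1 (eps / (2 * (t1 + 1)))) as [d [hd hsm]].
{ apply Rdiv_lt_0_compat; lra. }
exists (Rmin d (eps / (2 * M))).
split. { apply Rmin_glb_lt; [exact hd | apply Rdiv_lt_0_compat; lra]. }
intros s t hs hst ht hts.
assert (hts1 : t - s < d) by (apply Rlt_le_trans with (1 := hts), Rmin_l).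
assert (hts2 : (t - s) * M <= eps / 2).
{ assert (t - s < eps / (2 * M)) by (apply Rlt_le_trans with (1 := hts), Rmin_r).
  replace (eps / 2) with (eps / (2 * M) * M) by (field; lra). nra. }
replace t with (s + (t - s)) at 1 by ring.
rewrite convolution_shift by lra.
replace (s + (t - s)) with t by ring.
set (J := RInt _ s t).
assert (hJ : norm J <= (t - s) * M).
{ apply norm_RInt_convolution_le; [exact hst |].
  intros r hr. left. apply hM. lra. }
assert (hI : norm (minus (S (t - s) (convolution S f s)) (convolution S f s)) <=
             (s - 0) * (eps / (2 * (t1 + 1)))).
{ apply (norm_RInt_le_const
    (fun r => minus (S (t - s) (S (s - r) (f r))) (S (s - r) (f r))) 0 s _ _ hs).
  - intros r hr. rewrite flow_commute by lra. rewrite <- flow_minus.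
    apply Rle_trans with (1 := flow_contract _ _). left. apply hsm; lra.
  - apply (is_RInt_minus (V := V));
      [apply is_RInt_apply; [apply (flow_linear _ _ hS) |] |];
      apply (RInt_correct (V := V)), ex_RInt_convolution. }
assert (hs2 : (s - 0) * (eps / (2 * (t1 + 1))) < eps / 2).
{ replace (eps / 2) with ((t1 + 1) * (eps / (2 * (t1 + 1)))) by (field; lra).
  apply Rmult_lt_compat_r; [apply Rdiv_lt_0_compat |]; lra. }
assert (heq : minus (plus (S (t - s) (convolution S f s)) J) (convolution S f s) =
              plus (minus (S (t - s) (convolution S f s)) (convolution S f s)) J)
  by vec_eq hip.
rewrite heq.
apply Rle_lt_trans with (1 := norm_plus_le _ _). lra.
Qed.

Context (x0 : V).

Lemma trajectory_continuous (t eps : R) : 0 <= t -> 0 < eps ->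
  exists delta, 0 < delta /\ forall s, 0 <= s -> Rabs (s - t) < delta ->
    norm (minus (trajectory S f x0 s) (trajectory S f x0 t)) < eps.
Proof.
intros ht heps.
destruct (convolution_modulus (t + 1) (eps / 2)) as [d1 [hd1 h1]]; [lra | lra |].
destruct (flow_dist_small (fun _ => x0) t (continuous_const x0 t) (eps / 2))
  as [d2 [hd2 h2]]; [lra |].
exists (Rmin (Rmin d1 d2) 1).
split. { repeat apply Rmin_glb_lt; lra. }
intros s hs hst.
assert (hd : Rabs (s - t) < d1 /\ Rabs (s - t) < d2 /\ Rabs (s - t) < 1).
{ revert hst. unfold Rmin. repeat destruct Rle_dec; lra. }
destruct hd as [hsd1 [hsd2 hs1]]. apply Rabs_def2 in hs1.
assert (hx : norm (minus (S s x0) (S t x0)) < eps / 2)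
  by (apply (h2 s t t); [rewrite Rminus_diag, Rabs_R0; lra | exact hsd2]).
assert (hc : norm (minus (convolution S f t) (convolution S f s)) < eps / 2).
{ apply Rabs_def2 in hsd1. destruct (Rle_lt_dec s t).
  - apply h1; lra.
  - rewrite norm_minus_sym. apply h1; lra. }
assert (heq : minus (trajectory S f x0 s) (trajectory S f x0 t) =
              plus (minus (S s x0) (S t x0)) (minus (convolution S f t) (convolution S f s)))
  by (unfold trajectory; vec_eq hip).
rewrite heq.
apply Rle_lt_trans with (1 := norm_plus_le _ _). lra.
Qed.

Lemma trajectory_zero : trajectory S f x0 0 = x0.
Proof.
unfold trajectory, convolution. rewrite (flow_neg _ _ hS) by lra.
assert (h : RInt (fun s => S (0 - s) (f s)) 0 0 = zero) by apply (RInt_point (V := V)).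
rewrite h. vec_eq hip.
Qed.

(** The last piece of the integral is compared with [scal h (S h (f t))], not with [scal h (f t)]:
    then [S h] factors out of everything but the error [K], and the full decay factor multiplies the
    combined vector. *)
Lemma trajectory_step (t eta : R) : 0 <= t -> 0 < eta ->
  exists delta, 0 < delta /\ forall h, 0 < h < delta ->
    norm (trajectory S f x0 (t + h)) <=
    exp (- alpha * h) * norm (minus (trajectory S f x0 t) (scal h (f t))) + h * eta.
Proof.
intros ht heta.
destruct (flow_dist_small f t (hf t) eta heta) as [d [hd hsm]].
exists d. split; [exact hd |]. intros h hh.
set (J := RInt (fun s => S (t + h - s) (f s)) t (t + h)).
set (K := minus J (scal h (S h (f t)))).
assert (hK : norm K <= h * eta).
{ replace (h * eta) with ((t + h - t) * eta) by ring.
  apply (norm_RInt_le_const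
    (fun s => minus (S (t + h - s) (f s)) (S h (f t))) t (t + h)); [lra | |].
  - intros s hs. left. apply hsm; apply Rabs_def1; lra.
  - apply (is_RInt_minus (V := V)).
    + apply (RInt_correct (V := V)), ex_RInt_convolution.
    + assert (hc : scal h (S h (f t)) = scal (t + h - t) (S h (f t)))
        by (replace (t + h - t) with h by ring; reflexivity).
      rewrite hc. apply (is_RInt_const (V := V)). }
assert (heq : trajectory S f x0 (t + h) =
              minus (S h (minus (trajectory S f x0 t) (scal h (f t)))) K).
{ rewrite flow_minus.
  assert (hsc : S h (scal h (f t)) = scal h (S h (f t)))
    by exact (linear_scal _ (flow_linear _ _ hS h) h (f t)).
  rewrite hsc. unfold K, trajectory at 1.
  rewrite convolution_shift by lra. fold J.
  unfold trajectory. rewrite flow_minus.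
  rewrite <- (flow_plus _ _ hS h t) by lra. rewrite (Rplus_comm h t).
  vec_eq hip. }
rewrite heq.
apply Rle_trans with (norm (S h (minus (trajectory S f x0 t) (scal h (f t)))) + norm (opp K)).
{ apply norm_plus_le. }
apply Rplus_le_compat; [apply (flow_norm _ _ hS); lra |].
rewrite norm_opp_eq. exact hK.
Qed.

(** Obtained by squaring [trajectory_step]: the factor [exp (- 2 * alpha * h)] produces the
    dissipation, the cross term of [norm (minus x (scal h (f t))) ^ 2] produces the pairing, and the
    rest is absorbed by [eps]. *)
Lemma energy_step (t eps : R) : 0 <= t -> 0 < eps ->
  exists delta, 0 < delta /\ forall h, 0 < h < delta ->
    norm (trajectory S f x0 (t + h)) ^ 2 <= norm (trajectory S f x0 t) ^ 2 +
      h * (- 2 * alpha * norm (trajectory S f x0 t) ^ 2 - 2 * ip (trajectory S f x0 t) (f t) + eps).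
Proof.
intros ht heps.
set (x := trajectory S f x0 t). set (a := norm x). set (c := norm (f t)). set (q := ip x (f t)).
assert (ha : 0 <= a) by apply norm_ge_0.
assert (hc : 0 <= c) by apply norm_ge_0.
assert (hq : Rabs q <= a * c) by apply (cauchy_schwarz hip).
set (eta := Rmin 1 (eps / (4 * (a + c + 1)))).
assert (heta : 0 < eta) by (apply Rmin_glb_lt; [| apply Rdiv_lt_0_compat]; lra).
assert (heta1 : eta <= 1) by apply Rmin_l.
assert (heta2 : 2 * eta * (a + c) <= eps / 2).
{ assert (eta <= eps / (4 * (a + c + 1))) by apply Rmin_r.
  apply Rle_trans with (2 * (eps / (4 * (a + c + 1))) * (a + c + 1)).
  - nra.
  - right. field. lra. }
(* [C] collects all coefficients of [h ^ 2] (bounds [h1], [h2], [h3], [h5] below). It takes one half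
   of [eps]; the [eta] term [h4] takes the other. *)
set (C := 4 * alpha ^ 2 * a ^ 2 + 4 * alpha * a * c + c ^ 2 + 1).
assert (hac : 0 <= a * c) by (apply Rmult_le_pos; assumption).
assert (hC : 0 < C).
{ assert (0 <= alpha * (a * c)) by (apply Rmult_le_pos; lra).
  pose proof (pow2_ge_0 (alpha * a)). pose proof (pow2_ge_0 c).
  unfold C. lra. }
destruct (trajectory_step t eta ht heta) as [d [hd hstep]].
exists (Rmin d (Rmin 1 (eps / (2 * C)))).
split. { repeat apply Rmin_glb_lt; [exact hd | lra | apply Rdiv_lt_0_compat; lra]. }
intros h [hh0 hh].
assert (hhd : h < d) by (apply Rlt_le_trans with (1 := hh), Rmin_l).
assert (hh' : h < Rmin 1 (eps / (2 * C))) by (apply Rlt_le_trans with (1 := hh), Rmin_r).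
assert (hh1 : h < 1) by (apply Rlt_le_trans with (1 := hh'), Rmin_l).
assert (hhC : h * C <= eps / 2).
{ assert (h < eps / (2 * C)) by (apply Rlt_le_trans with (1 := hh'), Rmin_r).
  replace (eps / 2) with (eps / (2 * C) * C) by (field; lra). nra. }
specialize (hstep h (Logic.conj hh0 hhd)). fold x in hstep.
set (p := norm (minus x (scal h (f t)))) in hstep.
assert (hp0 : 0 <= p) by apply norm_ge_0.
assert (hp : p ^ 2 = a ^ 2 - 2 * h * q + h ^ 2 * c ^ 2).
{ unfold p, a, c, q. rewrite <- !(ip_norm _ hip). expand_ip hip.
  rewrite (ip_sym _ hip x (minus _ _)), (ip_sym _ hip (f t) (minus _ _)). expand_ip hip.
  rewrite (ip_sym _ hip (f t) x). ring. }
apply Rabs_le_between in hq.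
assert (hp1 : p <= a + c).
{ apply Rsqr_incr_0; [| exact hp0 | lra]. rewrite !Rsqr_pow2, hp. 
  assert (h * (- q) <= 1 * (a * c)) by (apply Rle_trans with (h * (a * c)); nra).
  assert (h ^ 2 * c ^ 2 <= 1 * c ^ 2) by (apply Rmult_le_compat_r; nra). nra. }
set (E := exp (- alpha * h)) in hstep.
assert (hE0 : 0 < E) by apply exp_pos.
(* Both bounds on [E ^ 2] come from [1 + x <= exp x]. This one gives [E ^ 2 <= 1 / (1 + 2 y) <= 1 -
   2 y + 4 y ^ 2] with [y = alpha * h]. *)
assert (hE : E ^ 2 * (1 + 2 * (alpha * h)) <= 1).
{ assert (hE' : E ^ 2 * exp (2 * (alpha * h)) = 1).
  { unfold E. simpl. rewrite Rmult_1_r, <- !exp_plus, <- exp_0. f_equal. ring. }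
  pose proof (exp_ineq1_le (2 * (alpha * h))).
  apply Rle_trans with (2 := Req_le _ _ hE').
  apply Rmult_le_compat_l; [apply pow2_ge_0 | assumption]. }
assert (hE1 : 1 - 2 * (alpha * h) <= E ^ 2).
{ assert (hE' : E ^ 2 = exp (- (2 * (alpha * h)))).
  { unfold E. simpl. rewrite Rmult_1_r, <- exp_plus. f_equal. ring. }
  rewrite hE'. pose proof (exp_ineq1_le (- (2 * (alpha * h)))). lra. }
set (y := alpha * h) in *.
assert (hy : 0 < y) by (apply Rmult_lt_0_compat; assumption).
set (Q := E ^ 2) in *.
assert (hQ0 : 0 < Q) by (apply pow_lt; exact hE0).
assert (hQ1 : Q <= 1) by nra.
assert (hE2 : E <= 1) by (unfold Q in hQ1; nra).
assert (hQ : Q <= 1 - 2 * y + 4 * y ^ 2) by nra.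
assert (hn : norm (trajectory S f x0 (t + h)) ^ 2 <= (E * p + h * eta) ^ 2)
  by (apply pow_incr; split; [apply norm_ge_0 | exact hstep]).
apply Rle_trans with (1 := hn).
replace ((E * p + h * eta) ^ 2) with
  (Q * p ^ 2 + h * (2 * eta * (E * p)) + h * (h * eta ^ 2))
  by (unfold Q; ring).
rewrite hp.
assert (h1 : Q * a ^ 2 <= (1 - 2 * y + 4 * y ^ 2) * a ^ 2)
  by (apply Rmult_le_compat_r; [apply pow2_ge_0 | exact hQ]).
assert (h2 : Q * (- 2 * h * q) <= - 2 * h * q + 2 * h * (a * c) * (2 * y)).
{ assert (q * (1 - Q) <= a * c * (2 * y))
    by (apply Rle_trans with (a * c * (1 - Q)); nra).
  nra. }
assert (h3 : Q * (h ^ 2 * c ^ 2) <= h ^ 2 * c ^ 2).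
{ assert (0 <= h ^ 2 * c ^ 2) by (apply Rmult_le_pos; apply pow2_ge_0). nra. }
assert (h4 : h * (2 * eta * (E * p)) <= h * (eps / 2)).
{ apply Rmult_le_compat_l; [lra |]. apply Rle_trans with (2 := heta2).
  apply Rmult_le_compat_l; [lra |].
  assert (E * p <= 1 * p) by (apply Rmult_le_compat_r; assumption). lra. }
assert (h5 : h * (h * eta ^ 2) <= h * (h * 1)).
{ apply Rmult_le_compat_l; [lra |]. apply Rmult_le_compat_l; [lra |]. nra. }
assert (h6 : h * (h * C) <= h * (eps / 2)) by (apply Rmult_le_compat_l; lra).
unfold C in h6. unfold y in *. lra.
Qed.

(** Of the rate [2 * alpha] supplied by the semigroup, one [alpha] is spent on the forcing and the
    other remains as the decay rate. *)
Lemma trajectory_decay (t1 K : R) : 0 <= K ->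
  (forall t, 0 <= t < t1 ->
     - 2 * ip (trajectory S f x0 t) (f t) <= alpha * norm (trajectory S f x0 t) ^ 2 + K) ->
  forall t, 0 <= t <= t1 ->
    norm (trajectory S f x0 t) ^ 2 <= exp (- alpha * t) * norm x0 ^ 2 + K / alpha.
Proof.
intros hK hdiss t ht.
assert (h0 : norm x0 ^ 2 = norm (trajectory S f x0 0) ^ 2) by (rewrite trajectory_zero; reflexivity).
rewrite h0.
apply (dini_decay (fun t => norm (trajectory S f x0 t) ^ 2) t1 alpha K); try assumption.
- apply pow2_ge_0.
- clear t ht. intros t eps ht heps. set (m := norm (trajectory S f x0 t)).
  assert (hm : 0 <= m) by apply norm_ge_0.
  destruct (trajectory_continuous t (Rmin 1 (eps / (2 * m + 1)))) as [d [hd h]];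
    [exact ht | apply Rmin_glb_lt; [lra | apply Rdiv_lt_0_compat; lra] |].
  exists d. split; [exact hd |]. intros s hs hst. specialize (h s hs hst).
  assert (h1 := Rlt_le_trans _ _ _ h (Rmin_l _ _)).
  assert (h2 := Rlt_le_trans _ _ _ h (Rmin_r _ _)).
  pose proof (norm_triangle_inv (trajectory S f x0 s) (trajectory S f x0 t)) as h3.
  fold m in h3. set (n := norm (trajectory S f x0 s)) in *.
  replace (n ^ 2 - m ^ 2) with ((n - m) * (n + m)) by ring. rewrite Rabs_mult.
  assert (hn : 0 <= n) by apply norm_ge_0.
  rewrite (Rabs_pos_eq (n + m)) by lra.
  assert (h4 : Rabs (n - m) < 1) by (apply Rle_lt_trans with (1 := h3), h1).
  assert (h5 : Rabs (n - m) < eps / (2 * m + 1)) by (apply Rle_lt_trans with (1 := h3), h2).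
  apply Rabs_def2 in h4.
  replace eps with (eps / (2 * m + 1) * (2 * m + 1)) by (field; lra).
  apply Rle_lt_trans with (Rabs (n - m) * (2 * m + 1)).
  + apply Rmult_le_compat_l; [apply Rabs_pos | lra].
  + apply Rmult_lt_compat_r; lra.
- clear t ht. intros t eps ht heps.
  destruct (energy_step t eps) as [d [hd h]]; [lra | exact heps |].
  exists d. split; [exact hd |]. intros r hr.
  apply Rle_trans with (1 := h r hr).
  specialize (hdiss t ht). apply Rplus_le_compat_l, Rmult_le_compat_l; lra.
Qed.

End Convolution.

(** By linearity the difference is the trajectory from zero forced by [f - g]; the sign of the
    pairing is dissipation with [K = 0], so the decay bound is zero. *)
Lemma trajectory_unique (f g : R -> V) (x0 : V) (t1 : R) :
  (forall t, continuous f t) -> (forall t, continuous g t) ->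
  (forall t, 0 <= t < t1 ->
     0 <= ip (minus (f t) (g t)) (minus (trajectory S f x0 t) (trajectory S g x0 t))) ->
  forall t, 0 <= t <= t1 -> trajectory S f x0 t = trajectory S g x0 t.
Proof.
intros hf hg hmono t ht.
assert (hfg : forall t, continuous (fun s => minus (f s) (g s)) t)
  by (intros s; apply (continuous_minus (V := V)); [apply hf | apply hg]).
assert (hdiff : forall t, trajectory S (fun s => minus (f s) (g s)) zero t =
                  minus (trajectory S f x0 t) (trajectory S g x0 t)).
{ intros s. unfold trajectory.
  assert (hc : convolution S (fun r => minus (f r) (g r)) s =
               minus (convolution S f s) (convolution S g s)).
  { unfold convolution. apply is_RInt_unique.
    apply is_RInt_ext with (fun r => minus (S (s - r) (f r)) (S (s - r) (g r))).
    - intros r _. symmetry. apply flow_minus.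
    - apply (is_RInt_minus (V := V)); apply (RInt_correct (V := V));
        apply ex_RInt_convolution; assumption. }
  assert (hz : S s zero = zero) by exact (linear_zero _ (flow_linear _ _ hS s)).
  rewrite hc, hz. vec_eq hip. }
assert (hsq : norm (trajectory S (fun s => minus (f s) (g s)) zero t) ^ 2 <=
              exp (- alpha * t) * norm (zero : V) ^ 2 + 0 / alpha).
{ apply trajectory_decay with t1; [exact hfg | lra | | exact ht].
  intros s hs. rewrite hdiff, (ip_sym _ hip).
  specialize (hmono s hs).
  pose proof (pow2_ge_0 (norm (minus (trajectory S f x0 s) (trajectory S g x0 s)))). nra. }
rewrite hdiff in hsq.
assert (hn0 : norm (zero : V) = 0) by exact (norm_zero (V := V)).
rewrite hn0 in hsq.
apply norm_minus_eq_zero, Rsqr_0_uniq. rewrite Rsqr_pow2.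
apply Rle_antisym; [| apply pow2_ge_0].
replace 0 with (exp (- alpha * t) * 0 ^ 2 + 0 / alpha) by (field; lra). exact hsq.
Qed.

(** * Picard iteration for a globally Lipschitz nonlinearity *)

Section Picard.

Context (N : R -> V -> V) (L t1 : R) (x0 : V) (hL : 0 < L) (ht1 : 0 <= t1)
  (hlip : forall s x y, norm (minus (N s x) (N s y)) <= L * norm (minus x y))
  (hN : forall x, (forall t, continuous x t) -> forall t, continuous (fun s => N s (x s)) t).

(** The clamp makes iterates continuous on the whole line and determined by their values on
    [[0, t1]], so bounds on that interval hold everywhere. *)
Let Phi (x : R -> V) (t : R) : V :=
  trajectory S (fun s => N s (x s)) x0 (clamp t1 t).

Lemma picard_step_continuous (x : R -> V) : (forall t, continuous x t) ->
  forall t, continuous (Phi x) t.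
Proof.
intros hx.
apply (continuous_on_comp_nonexpansive (fun t => 0 <= t <= t1)
  (trajectory S (fun s => N s (x s)) x0) (clamp t1));
  [| intros t; apply clamp_range, ht1 | apply clamp_nonexpansive].
intros s hs. apply filterlim_within_norm_iff. intros eps heps.
destruct (trajectory_continuous (hN x hx) x0 s eps) as [d [hd h]]; [lra | exact heps |].
exists d. split; [exact hd |]. intros r hr hr1. apply h; [lra | exact hr].
Qed.

(* In the weighted norm [sup_t exp (- 2 L t) |x t|] the Picard map contracts by 1/2. *)
Lemma picard_step_contracts (x y : R -> V) (c : R) :
  (forall t, continuous x t) -> (forall t, continuous y t) ->
  (forall t, 0 <= t <= t1 -> norm (minus (x t) (y t)) <= c * exp (2 * L * t)) ->
  forall t, 0 <= t <= t1 ->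
    norm (minus (trajectory S (fun s => N s (x s)) x0 t)
                (trajectory S (fun s => N s (y s)) x0 t)) <= c / 2 * exp (2 * L * t).
Proof.
intros hx hy hxy t ht.
assert (hc : 0 <= c).
{ specialize (hxy 0 ltac:(lra)). rewrite Rmult_0_r, exp_0 in hxy.
  pose proof (norm_ge_0 (minus (x 0) (y 0))). lra. }
assert (heq : minus (trajectory S (fun s => N s (x s)) x0 t)
                    (trajectory S (fun s => N s (y s)) x0 t) =
              minus (convolution S (fun s => N s (y s)) t)
                    (convolution S (fun s => N s (x s)) t))
  by (unfold trajectory; vec_eq hip).
rewrite heq.
apply Rle_trans with (c / 2 * exp (2 * L * t) - c / 2 * exp (2 * L * 0)).
- apply (norm_RInt_le
    (fun s => minus (S (t - s) (N s (y s))) (S (t - s) (N s (x s))))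
    (fun s => L * (c * exp (2 * L * s))) 0 t); [lra | | |].
  + intros s hs. rewrite <- flow_minus.
    apply Rle_trans with (1 := flow_contract _ _).
    apply Rle_trans with (1 := hlip s _ _).
    apply Rmult_le_compat_l; [lra |]. rewrite norm_minus_sym. apply hxy. lra.
  + apply (is_RInt_minus (V := V)); apply (RInt_correct (V := V));
      apply ex_RInt_convolution, hN; assumption.
  + apply (is_RInt_derive (V := R_CompleteNormedModule)
      (fun s => c / 2 * exp (2 * L * s))).
    * intros s _. auto_derive; [exact I | field].
    * intros s _. apply (ex_derive_continuous (fun s => L * (c * exp (2 * L * s)))).
      auto_derive. exact I.
- assert (0 <= c / 2 * exp (2 * L * 0)) by (apply Rmult_le_pos; [lra | left; apply exp_pos]).
  lra.
Qed.

Lemma picard_solution : exists x : R -> V, (forall t, continuous x t) /\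
  forall t, 0 <= t <= t1 -> x t = trajectory S (fun s => N s (x s)) x0 t.
Proof.
set (u := fun n => Nat.iter n Phi (fun _ => x0)).
assert (hu : forall n t, continuous (u n) t).
{ induction n as [| n IH]; [intros t; apply continuous_const |].
  exact (picard_step_continuous (u n) IH). }
assert (hclamp : forall t, 0 <= clamp t1 t <= t1) by (intros t; apply clamp_range, ht1).
assert (hstep : forall n t, 0 <= t <= t1 ->
          u (Datatypes.S n) t = trajectory S (fun s => N s (u n s)) x0 t).
{ intros n t ht. change (u (Datatypes.S n) t) with (Phi (u n) t).
  unfold Phi. rewrite clamp_id by exact ht. reflexivity. }
assert (huclamp : forall n t, u n t = u n (clamp t1 t)).
{ intros [| n] t; [reflexivity |].
  change (Phi (u n) t = Phi (u n) (clamp t1 t)). unfold Phi.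
  rewrite (clamp_id t1 (clamp t1 t)) by apply hclamp. reflexivity. }
destruct (bounded_continuity (fun t => minus (u 1%nat t) (u 0%nat t)) 0 t1) as [C hC].
{ intros t _. apply (continuous_minus (V := V)); apply hu. }
assert (hCpos : 0 < C).
{ apply Rle_lt_trans with (2 := hC 0 ltac:(lra)). apply norm_ge_0. }
assert (hdiff : forall n t, 0 <= t <= t1 ->
          norm (minus (u (Datatypes.S n) t) (u n t)) <= C / 2 ^ n * exp (2 * L * t)).
{ induction n as [| n IH]; intros t ht.
  - assert (1 <= exp (2 * L * t)) by (rewrite <- exp_0; apply exp_le_compat; nra).
    specialize (hC t ht). simpl (2 ^ 0). apply Rle_trans with C; [left; exact hC | nra].
  - rewrite !hstep by exact ht.
    replace (C / 2 ^ Datatypes.S n) with (C / 2 ^ n / 2)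
      by (simpl; field; apply pow_nonzero; lra).
    apply picard_step_contracts; [apply hu | apply hu | exact IH | exact ht]. }
(* [D] pays for removing the exponential weight: the steps become geometric uniformly in [t]. *)
set (D := C * exp (2 * L * t1)).
assert (hE : forall t, t <= t1 -> exp (2 * L * t) <= exp (2 * L * t1))
  by (intros t ht; apply exp_le_compat; nra).
assert (hpow : forall n, 0 < 2 ^ n) by (intros n; apply pow_lt; lra).
assert (hunif : forall t n, norm (minus (u (Datatypes.S n) t) (u n t)) <= D / 2 ^ n).
{ intros t n. rewrite (huclamp (Datatypes.S n)), (huclamp n).
  apply Rle_trans with (1 := hdiff n _ (hclamp t)).
  replace (D / 2 ^ n) with (C / 2 ^ n * exp (2 * L * t1))
    by (unfold D; field; apply Rgt_not_eq, hpow).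
  apply Rmult_le_compat_l; [apply Rdiv_le_0_compat; [lra | apply hpow] |].
  apply hE, hclamp. }
set (x := fun t => iota (fun l : V => filterlim (fun n => u n t) eventually (locally l))).
assert (hx : forall t n, norm (minus (x t) (u n t)) <= 2 * D / 2 ^ n).
{ intros t n.
  destruct (geometric_cauchy_limit (fun n => u n t) D (hunif t)) as [l [hl hln]].
  assert (hxl : x t = l) by exact (iota_filterlim_locally _ l hl).
  rewrite hxl. apply hln. }
assert (hxcont : forall t, continuous x t).
{ intros t. apply continuous_norm_iff. intros eps heps.
  destruct (div_pow2_small (2 * D) (eps / 3)) as [n hn]; [lra |].
  destruct (proj1 (continuous_norm_iff (u n) t) (hu n t) (eps / 3)) as [d [hd h]]; [lra |].
  exists d. split; [exact hd |]. intros s hs. specialize (h s hs).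
  apply Rle_lt_trans with (1 := norm_minus_triangle _ (u n s) _).
  pose proof (norm_minus_triangle (u n s) (u n t) (x t)) as h1.
  rewrite (norm_minus_sym (u n t)) in h1.
  pose proof (hx s n). pose proof (hx t n). lra. }
exists x. split; [exact hxcont |]. intros t ht.
apply norm_minus_eq_zero. apply Rle_antisym; [| apply norm_ge_0]. apply le_epsilon. intros eps heps.
  rewrite Rplus_0_l.
  (* Both sides are compared with the iterate [n + 1]: [x] is within [2 * D / 2 ^ (n + 1)] of it,
     and the contraction halves the weighted distance from [x] to the iterate [n]. *)
  destruct (div_pow2_small (D + D * exp (2 * L * t1)) eps heps) as [n hn].
  left. apply Rle_lt_trans with (2 := hn).
  apply Rle_trans with (1 := norm_minus_triangle _ (u (Datatypes.S n) t) _).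
  replace ((D + D * exp (2 * L * t1)) / 2 ^ n) with
    (2 * D / 2 ^ Datatypes.S n + 2 * D / 2 ^ n / 2 * exp (2 * L * t1))
    by (simpl; field; apply Rgt_not_eq, hpow).
  apply Rplus_le_compat; [apply hx |].
  rewrite hstep by exact ht.
  assert (hD : 0 <= 2 * D / 2 ^ n).
  { apply Rdiv_le_0_compat; [| apply hpow]. unfold D.
    pose proof (exp_pos (2 * L * t1)). nra. }
  apply Rle_trans with (2 * D / 2 ^ n / 2 * exp (2 * L * t)).
  - apply picard_step_contracts; [apply hu | exact hxcont | | exact ht].
    intros s hs. rewrite norm_minus_sym. apply Rle_trans with (1 := hx s n).
    assert (1 <= exp (2 * L * s)) by (rewrite <- exp_0; apply exp_le_compat; nra). nra.
  - apply Rmult_le_compat_l; [lra | apply hE; lra].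
Qed.

End Picard.

End Flow.

(** * Monotone feedback *)

Lemma continuous_locally_lipschitz {V W : CompleteNormedModule R_AbsRing}
  (g : V -> W) (f : R -> V) (t : R) :
  (forall r, 0 < r -> exists k, 0 < k /\ forall u v : V, norm u <= r -> norm v <= r ->
     norm (minus (g u) (g v)) <= k * norm (minus u v)) ->
  continuous f t -> continuous (fun s => g (f s)) t.
Proof.
intros hg hf.
destruct (hg (norm (f t) + 1)) as [k [hk hlip]].
{ pose proof (norm_ge_0 (f t)). lra. }
apply continuous_norm_iff. intros eps heps.
destruct (proj1 (continuous_norm_iff f t) hf (Rmin 1 (eps / k))) as [d [hd h]].
{ apply Rmin_glb_lt; [lra | apply Rdiv_lt_0_compat; assumption]. }
exists d. split; [exact hd |]. intros s hs. specialize (h s hs).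
assert (h1 := Rlt_le_trans _ _ _ h (Rmin_l _ _)).
assert (h2 := Rlt_le_trans _ _ _ h (Rmin_r _ _)).
pose proof (norm_triangle_inv (f s) (f t)) as h3. apply Rabs_le_between in h3.
assert (h4 : norm (f s) - norm (f t) <= 1) by (apply Rle_trans with (1 := proj2 h3); left; exact h1).
apply Rle_lt_trans with (1 := hlip (f s) (f t) ltac:(lra) ltac:(lra)).
replace eps with (k * (eps / k)) by (field; lra).
apply Rmult_lt_compat_l; assumption.
Qed.

(** The retraction onto the closed ball of radius [r], without a case distinction: inside the ball
    the factor is [r / r]. *)
Definition radial {W : CompleteNormedModule R_AbsRing} (r : R) (u : W) : W :=
  scal (r / Rmax r (norm u)) u.

Section Radial.

Context {W : CompleteNormedModule R_AbsRing} {ip : W -> W -> R} (hip : is_inner ip).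
Context (r : R) (hr : 0 < r).

Lemma radial_id (u : W) : norm u <= r -> radial r u = u.
Proof.
intros hu. unfold radial. rewrite Rmax_left by exact hu. unfold Rdiv.
rewrite Rinv_r by lra. exact (scal_one u).
Qed.

Lemma radial_factor (u : W) : exists c, 1 <= c /\ u = scal c (radial r u).
Proof.
assert (hm : r <= Rmax r (norm u)) by apply Rmax_l.
exists (Rmax r (norm u) / r). split.
- apply Rle_div_r; lra.
- unfold radial. vec_eq hip. field. lra.
Qed.

Lemma norm_radial_le (u : W) : norm (radial r u) <= r.
Proof.
assert (hm : r <= Rmax r (norm u)) by apply Rmax_l.
unfold radial. rewrite (norm_scal_R hip), Rabs_pos_eq by (apply Rdiv_le_0_compat; lra).
replace r with (r / Rmax r (norm u) * Rmax r (norm u)) at 3 by (field; lra).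
apply Rmult_le_compat_l; [apply Rdiv_le_0_compat; lra | apply Rmax_r].
Qed.

(** The difference is [r / a] times [u - v] plus a correction along [v] caused by the change of the
    scaling factor; each has norm at most [norm (minus u v)]. *)
Lemma radial_lipschitz (u v : W) :
  norm (minus (radial r u) (radial r v)) <= 2 * norm (minus u v).
Proof.
set (a := Rmax r (norm u)). set (b := Rmax r (norm v)).
assert (ha : r <= a) by apply Rmax_l.
assert (hb : r <= b) by apply Rmax_l.
assert (hv : norm v <= b) by apply Rmax_r.
assert (hab : Rabs (b - a) <= norm (minus u v)).
{ apply Rle_trans with (2 := norm_triangle_inv u v).
  unfold a, b, Rmax, Rabs. repeat destruct Rle_dec; repeat destruct Rcase_abs; lra. }
assert (heq : minus (radial r u) (radial r v) =
              plus (scal (r / a) (minus u v)) (scal (r / a * ((b - a) / b)) v)).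
{ unfold radial. fold a b. vec_eq hip. field. lra. }
rewrite heq. apply Rle_trans with (1 := norm_plus_le _ _).
rewrite !(norm_scal_R hip).
assert (hra : 0 <= r / a <= 1).
{ split; [apply Rdiv_le_0_compat; lra |]. apply Rle_div_l; lra. }
rewrite Rabs_mult, !(Rabs_pos_eq (r / a)) by lra.
rewrite Rabs_div, (Rabs_pos_eq b) by lra.
pose proof (norm_ge_0 (minus u v)) as hn.
assert (h1 : r / a * norm (minus u v) <= 1 * norm (minus u v))
  by (apply Rmult_le_compat_r; lra).
assert (h2 : Rabs (b - a) / b * norm v <= Rabs (b - a)).
{ replace (Rabs (b - a)) with (Rabs (b - a) / b * b) at 2 by (field; lra).
  apply Rmult_le_compat_l; [| exact hv].
  apply Rdiv_le_0_compat; [apply Rabs_pos | lra]. }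
assert (h3 : r / a * (Rabs (b - a) / b * norm v) <= 1 * Rabs (b - a)).
{ apply Rmult_le_compat; [lra | | lra | exact h2].
  apply Rmult_le_pos; [apply Rdiv_le_0_compat; [apply Rabs_pos | lra] | apply norm_ge_0]. }
lra.
Qed.

End Radial.

Lemma trajectory_ext {V : CompleteNormedModule R_AbsRing} (S : R -> V -> V)
  (f g : R -> V) (x0 : V) (t : R) :
  0 <= t -> (forall s, 0 < s < t -> f s = g s) ->
  trajectory S f x0 t = trajectory S g x0 t.
Proof.
intros ht hfg. unfold trajectory. f_equal. unfold convolution.
apply (RInt_ext (V := V)). intros s. rewrite Rmin_left, Rmax_right by exact ht.
intros hs. rewrite hfg by exact hs. reflexivity.
Qed.

(** Continuity is asked on the whole line and the equation on [[0, t1]] only, so that the generated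
    forcing meets the hypotheses of the convolution lemmas. *)
Definition is_solution {V W : CompleteNormedModule R_AbsRing} (S : R -> V -> V)
  (B : W -> V) (Bs : V -> W) (sigma : W -> W) (x0 : V) (d : R -> W) (t1 : R)
  (x : R -> V) : Prop :=
  (forall t, continuous x t) /\
  forall t, 0 <= t <= t1 ->
    x t = trajectory S (fun s => B (sigma (plus (Bs (x s)) (d s)))) x0 t.

(** * The closed loop: existence, uniqueness and bounds *)

Section Feedback.

Context {V W : CompleteNormedModule R_AbsRing}
  {ipV : V -> V -> R} {ipW : W -> W -> R} (hipV : is_inner ipV) (hipW : is_inner ipW)
  {alpha : R} (halpha : 0 < alpha) {S : R -> V -> V} (hS : contraction_flow alpha S)
  {B : W -> V} {Bs : V -> W} {b : R} (hb : 0 < b) (hB : is_linear B)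
  (hBnorm : forall u, norm (B u) <= b * norm u)
  (hBs : forall u x, ipV (B u) x = ipW u (Bs x))
  {sigma : W -> W} (hsigma0 : sigma zero = zero)
  (hsigma_lip : forall r, 0 < r -> exists k, 0 < k /\
     forall u v : W, norm u <= r -> norm v <= r ->
       norm (minus (sigma u) (sigma v)) <= k * norm (minus u v))
  (hsigma_mono : forall u v, 0 <= ipW (minus (sigma u) (sigma v)) (minus u v)).

Lemma input_minus (u v : W) : B (minus u v) = minus (B u) (B v).
Proof.
transitivity (plus (B u) (B (opp v))).
- exact (linear_plus _ hB u (opp v)).
- unfold minus. f_equal. exact (linear_opp _ _ hB).
Qed.

(** Compatibility of [Bs] with differences, and below its norm bound, are read off from the adjoint
    relation. *)
Lemma adjoint_minus (x y : V) : Bs (minus x y) = minus (Bs x) (Bs y).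
Proof.
apply (ip_ext hipW). intros u. rewrite (ip_minus_l hipW), !(ip_sym _ hipW _ u), <- !hBs.
rewrite !(ip_sym _ hipV (B u)), (ip_minus_l hipV). reflexivity.
Qed.

Lemma norm_adjoint_le (x : V) : norm (Bs x) <= b * norm x.
Proof.
assert (h : norm (Bs x) ^ 2 <= b * norm (Bs x) * norm x).
{ rewrite <- (ip_norm _ hipW), <- hBs.
  apply Rle_trans with (1 := Rle_abs _), Rle_trans with (1 := cauchy_schwarz hipV _ _).
  apply Rmult_le_compat_r; [apply norm_ge_0 | apply hBnorm]. }
pose proof (norm_ge_0 (Bs x)) as h0. pose proof (norm_ge_0 x) as h1.
destruct (Req_dec (norm (Bs x)) 0) as [h2 | h2]; [rewrite h2; nra |].
apply Rmult_le_reg_l with (norm (Bs x)); [lra |]. nra.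
Qed.

Lemma continuous_observation (x : R -> V) (d : R -> W) (t : R) :
  continuous x t -> continuous d t -> continuous (fun s => plus (Bs (x s)) (d s)) t.
Proof.
intros hx hd. apply (continuous_plus (V := W)); [| exact hd].
apply (continuous_locally_lipschitz Bs x t); [| exact hx].
intros r _. exists b. split; [exact hb |]. intros u v _ _.
rewrite <- adjoint_minus. apply norm_adjoint_le.
Qed.

Lemma continuous_input (u : R -> W) (t : R) :
  continuous u t -> continuous (fun s => B (u s)) t.
Proof.
apply continuous_locally_lipschitz. intros r _. exists b. split; [exact hb |].
intros v w _ _. rewrite <- input_minus. apply hBnorm.
Qed.

Lemma continuous_feedback (x : R -> V) (d : R -> W) :
  (forall t, continuous x t) -> (forall t, continuous d t) ->
  forall t, continuous (fun s => B (sigma (plus (Bs (x s)) (d s)))) t.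
Proof.
intros hx hd t.
apply continuous_input, continuous_locally_lipschitz; [exact hsigma_lip |].
apply continuous_observation; [apply hx | apply hd].
Qed.

(* With [p = radial r (Bs x + d)] and [Bs x + d = c p], [c >= 1], one has
   [Bs x = (p - d) + (c - 1) p]; monotonicity handles both summands. *)
Lemma truncated_feedback_lower_bound (r : R) (w d : W) : 0 < r -> norm d <= r ->
  - (2 * norm (sigma d) * norm w) <= ipW (sigma (radial r (plus w d))) w.
Proof.
intros hr hd.
destruct (radial_factor hipW r hr (plus w d)) as [c [hc heq]].
pose proof (radial_lipschitz hipW r hr (plus w d) d) as hlip.
rewrite (radial_id r hr d hd) in hlip.
set (p := radial r (plus w d)) in *.
assert (hwd : minus (plus w d) d = w) by vec_eq hipW.
rewrite hwd in hlip.
assert (hw : w = plus (minus p d) (scal (c - 1) p)).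
{ rewrite <- hwd at 1. rewrite heq. vec_eq hipW. }
rewrite (ip_sym _ hipW). rewrite hw at 2.
rewrite (ip_plus_l _ hipW), (ip_scal_l _ hipW).
pose proof (hsigma_mono p d) as h1. pose proof (hsigma_mono p zero) as h2.
rewrite hsigma0 in h2.
rewrite (ip_minus_l hipW), !(ip_sym _ hipW _ (minus p d)) in h1.
assert (h3 : 0 <= ipW p (sigma p)).
{ rewrite (ip_minus_l hipW), (ip_zero_l hipW), (ip_sym _ hipW), (ip_minus_l hipW) in h2.
  rewrite (ip_zero_l hipW) in h2. lra. }
pose proof (cauchy_schwarz hipW (minus p d) (sigma d)) as h4. apply Rabs_le_between in h4.
assert (h5 : norm (minus p d) * norm (sigma d) <= 2 * norm w * norm (sigma d))
  by (apply Rmult_le_compat_r; [apply norm_ge_0 | exact hlip]).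
assert (h6 : 0 <= (c - 1) * ipW p (sigma p)) by (apply Rmult_le_pos; lra).
lra.
Qed.

(** Moving [B] to the other side gives at most [4 * M * b * norm x], which Young's inequality
    splits. The lemma covers the untruncated feedback too, by taking [r] above
    [norm (plus (Bs x) d)]. *)
Lemma truncated_feedback_dissipation (r M : R) (x : V) (d : W) :
  0 < r -> norm d <= r -> norm (sigma d) <= M ->
  - 2 * ipV x (B (sigma (radial r (plus (Bs x) d)))) <=
  alpha * norm x ^ 2 + 4 * b ^ 2 * M ^ 2 / alpha.
Proof.
intros hr hd hM. rewrite (ip_sym _ hipV), hBs.
pose proof (truncated_feedback_lower_bound r (Bs x) d hr hd) as h.
assert (hx := norm_ge_0 x). assert (hs := norm_ge_0 (sigma d)).
assert (h1 : norm (sigma d) * norm (Bs x) <= M * (b * norm x))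
  by (apply Rmult_le_compat; try assumption; [apply norm_ge_0 | apply norm_adjoint_le]).
assert (h2 : 4 * (M * (b * norm x)) <= alpha * norm x ^ 2 + 4 * b ^ 2 * M ^ 2 / alpha).
{ assert (hsq : 0 <= alpha * (norm x - 2 * b * M / alpha) ^ 2)
    by (apply Rmult_le_pos; [lra | apply pow2_ge_0]).
  replace (alpha * (norm x - 2 * b * M / alpha) ^ 2) with
    (alpha * norm x ^ 2 + 4 * b ^ 2 * M ^ 2 / alpha - 4 * (M * (b * norm x))) in hsq
    by (field; lra).
  lra. }
lra.
Qed.

Lemma truncated_feedback_bound (r M t1 : R) (f : R -> V) (x0 : V) (d : R -> W) :
  0 < r -> (forall t, continuous f t) ->
  (forall t, 0 <= t < t1 ->
     f t = B (sigma (radial r (plus (Bs (trajectory S f x0 t)) (d t))))) ->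
  (forall t, 0 <= t < t1 -> norm (d t) <= r /\ norm (sigma (d t)) <= M) ->
  forall t, 0 <= t <= t1 ->
    norm (trajectory S f x0 t) ^ 2 <=
    exp (- alpha * t) * norm x0 ^ 2 + (2 * b * M / alpha) ^ 2.
Proof.
intros hr hf hfeq hd t ht.
replace ((2 * b * M / alpha) ^ 2) with (4 * b ^ 2 * M ^ 2 / alpha / alpha) by (field; lra).
apply (trajectory_decay hipV halpha hS hf x0 t1); [| | exact ht].
- apply Rdiv_le_0_compat; [| exact halpha].
  pose proof (pow2_ge_0 (b * M)). nra.
- intros s hs. destruct (hd s hs) as [hd1 hd2]. rewrite (hfeq s hs).
  apply truncated_feedback_dissipation; assumption.
Qed.

Lemma solution_exists (x0 : V) (d : R -> W) (t1 : R) :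
  0 <= t1 -> (forall t, continuous d t) -> exists x, is_solution S B Bs sigma x0 d t1 x.
Proof.
intros ht1 hd.
destruct (bounded_continuity d 0 t1) as [D hD]; [intros t _; apply hd |].
assert (hD0 : 0 < D) by (apply Rle_lt_trans with (1 := norm_ge_0 (d 0)), hD; lra).
destruct (hsigma_lip D hD0) as [kD [hkD hlipD]].
set (M := kD * D).
assert (hM0 : 0 < M) by (apply Rmult_lt_0_compat; assumption).
assert (hM : forall t, 0 <= t <= t1 -> norm (sigma (d t)) <= M).
{ intros t ht. specialize (hD t ht).
  assert (hz : norm (zero : W) = 0) by exact (norm_zero (V := W)).
  pose proof (hlipD (d t) zero ltac:(lra)
    (Rle_trans _ _ _ (Req_le _ _ hz) (Rlt_le _ _ hD0))) as h.
  rewrite hsigma0 in h.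
  assert (hm : forall u : W, minus u zero = u) by (intros u; vec_eq hipW).
  rewrite !hm in h. apply Rle_trans with (1 := h). apply Rmult_le_compat_l; lra. }
(* [C ^ 2] dominates the a priori bound of [truncated_feedback_bound]. As [C] is fixed before the
   radius, [r = b * C + D] can be taken to bound [norm (Bs x + d)] along the solution, where the
   retraction is then the identity. *)
set (C := norm x0 + 2 * b * M / alpha).
assert (hq : 0 <= 2 * b * M / alpha) by (apply Rdiv_le_0_compat; nra).
assert (hC : 0 <= C) by (pose proof (norm_ge_0 x0); unfold C; lra).
set (r := b * C + D).
assert (hr : 0 < r) by (assert (0 <= b * C) by (apply Rmult_le_pos; lra); unfold r; lra).
destruct (hsigma_lip r hr) as [k [hk hlip]].
set (N := fun s x => B (sigma (radial r (plus (Bs x) (d s))))).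
assert (htrunc : forall u v, norm (minus (sigma (radial r u)) (sigma (radial r v))) <=
                             2 * k * norm (minus u v)).
{ intros u v.
  apply Rle_trans with (1 := hlip _ _ (norm_radial_le hipW r hr u) (norm_radial_le hipW r hr v)).
  pose proof (radial_lipschitz hipW r hr u v).
  replace (2 * k * norm (minus u v)) with (k * (2 * norm (minus u v))) by ring.
  apply Rmult_le_compat_l; lra. }
(* The Lipschitz constant multiplies [b] for [B], [2 * k] for the truncated [sigma] and [b] for
   [Bs]. *)
destruct (picard_solution hipV halpha hS N (b * (2 * k * b)) t1 x0) as [x [hx hxeq]].
- repeat apply Rmult_lt_0_compat; lra.
- exact ht1.
- intros s x y. unfold N. rewrite <- input_minus.
  apply Rle_trans with (1 := hBnorm _).
  rewrite Rmult_assoc. apply Rmult_le_compat_l; [lra |].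
  apply Rle_trans with (1 := htrunc _ _).
  rewrite (Rmult_assoc (2 * k)). apply Rmult_le_compat_l; [lra |].
  assert (heq : minus (plus (Bs x) (d s)) (plus (Bs y) (d s)) = Bs (minus x y))
    by (rewrite adjoint_minus; vec_eq hipW).
  rewrite heq. apply norm_adjoint_le.
- intros x hx t. unfold N. apply continuous_input.
  apply (continuous_locally_lipschitz (fun u => sigma (radial r u))).
  + intros r' _. exists (2 * k). split; [lra |]. intros u v _ _. apply htrunc.
  + apply continuous_observation; [apply hx | apply hd].
- exists x. split; [exact hx |].
  assert (hf : forall t, continuous (fun s => N s (x s)) t).
  { intros t. unfold N. apply continuous_input.
    apply (continuous_locally_lipschitz (fun u => sigma (radial r u))).
    - intros r' _. exists (2 * k). split; [lra |]. intros u v _ _. apply htrunc.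
    - apply continuous_observation; [apply hx | apply hd]. }
  assert (hbound : forall t, 0 <= t <= t1 -> norm (x t) <= C).
  { intros t ht. apply Rsqr_incr_0; [| apply norm_ge_0 | exact hC].
    rewrite !Rsqr_pow2, hxeq by exact ht.
    apply Rle_trans with (exp (- alpha * t) * norm x0 ^ 2 + (2 * b * M / alpha) ^ 2).
    - apply (truncated_feedback_bound r M t1 _ x0 d hr hf); [| | exact ht].
      + intros s hs. rewrite <- hxeq by lra. reflexivity.
      + intros s hs. split; [| apply hM; lra].
        specialize (hD s ltac:(lra)).
        assert (0 <= b * C) by (apply Rmult_le_pos; lra). unfold r. lra.
    - assert (exp (- alpha * t) <= 1) by (rewrite <- exp_0; apply exp_le_compat; nra).
      pose proof (norm_ge_0 x0). unfold C. nra. }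
  intros t ht. rewrite hxeq at 1 by exact ht.
  apply trajectory_ext; [lra |]. intros s hs. unfold N.
  rewrite (radial_id r hr); [reflexivity |].
  apply Rle_trans with (1 := norm_plus_le _ _). unfold r.
  specialize (hD s ltac:(lra)). specialize (hbound s ltac:(lra)).
  pose proof (norm_adjoint_le (x s)).
  assert (b * norm (x s) <= b * C) by (apply Rmult_le_compat_l; lra). lra.
Qed.

Lemma solution_unique (x0 : V) (d : R -> W) (t1 : R) (x y : R -> V) :
  (forall t, continuous d t) -> is_solution S B Bs sigma x0 d t1 x -> is_solution S B Bs sigma x0 d t1 y ->
  forall t, 0 <= t <= t1 -> x t = y t.
Proof.
intros hd [hx hxeq] [hy hyeq] t ht.
rewrite hxeq, hyeq by exact ht.
apply (trajectory_unique hipV halpha hS) with t1; [| | | exact ht];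
  try (apply continuous_feedback; assumption).
intros s hs. rewrite <- hxeq, <- hyeq, <- input_minus, hBs, adjoint_minus by lra.
assert (heq : minus (Bs (x s)) (Bs (y s)) =
              minus (plus (Bs (x s)) (d s)) (plus (Bs (y s)) (d s))) by vec_eq hipW.
rewrite heq. apply hsigma_mono.
Qed.

(** On [[0, t1]] the continuous observation stays in some ball, so the solution also solves a
    truncated system. The bound [M] is asked on [[0, t1)] only, matching the essential supremum over
    [(0, t1)]. *)
Lemma solution_bound (M t1 : R) (x0 : V) (d : R -> W) (x : R -> V) :
  (forall t, continuous d t) -> is_solution S B Bs sigma x0 d t1 x ->
  (forall t, 0 <= t < t1 -> norm (sigma (d t)) <= M) ->
  forall t, 0 <= t <= t1 ->
    norm (x t) ^ 2 <= exp (- alpha * t) * norm x0 ^ 2 + (2 * b * M / alpha) ^ 2.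
Proof.
intros hd [hx hxeq] hM t ht. rewrite (hxeq t ht) at 1.
destruct (bounded_continuity d 0 t1) as [D hD]; [intros s _; apply hd |].
destruct (bounded_continuity (fun s => plus (Bs (x s)) (d s)) 0 t1) as [E hE].
{ intros s _. apply continuous_observation; [apply hx | apply hd]. }
assert (hD0 : 0 < D) by (apply Rle_lt_trans with (1 := norm_ge_0 (d 0)), hD; lra).
assert (hr : 0 < Rmax D E) by (apply Rlt_le_trans with (1 := hD0), Rmax_l).
apply (truncated_feedback_bound (Rmax D E) M t1 _ x0 d hr); [| | | exact ht].
- apply continuous_feedback; assumption.
- intros s hs. rewrite <- hxeq by lra. rewrite (radial_id _ hr); [reflexivity |].
  left. apply Rlt_le_trans with (2 := Rmax_r _ _), hE. lra.
- intros s hs. split; [| apply hM; exact hs].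
  left. apply Rlt_le_trans with (2 := Rmax_l _ _), hD. lra.
Qed.

Lemma solution_dini_bound (t1 eps : R) (x0 : V) (d : R -> W) (x : R -> V) :
  0 < t1 -> 0 < eps -> (forall t, continuous d t) -> is_solution S B Bs sigma x0 d t1 x ->
  exists delta, 0 < delta /\ forall h, 0 < h < delta ->
    norm (x h) ^ 2 - norm x0 ^ 2 <=
    h * (- alpha * norm x0 ^ 2 + 4 * b ^ 2 * norm (sigma (d 0)) ^ 2 / alpha + eps).
Proof.
intros ht1 heps hd [hx hxeq].
assert (hf := continuous_feedback x d hx hd).
destruct (energy_step hipV halpha hS hf x0 0 eps) as [e [he h]]; [lra | exact heps |].
exists (Rmin e t1). split; [apply Rmin_glb_lt; assumption |].
intros s hs.
assert (hse : s < e) by (apply Rlt_le_trans with (1 := proj2 hs), Rmin_l).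
assert (hst : s < t1) by (apply Rlt_le_trans with (1 := proj2 hs), Rmin_r).
specialize (h s ltac:(lra)). rewrite Rplus_0_l, <- hxeq in h by lra.
rewrite (trajectory_zero hipV hS) in h.
assert (hx0 : x 0 = x0) by (rewrite hxeq by lra; apply (trajectory_zero hipV hS)).
(* Large enough that both [d 0] and the initial observation lie in the ball; [+ 1] makes it
   positive. *)
set (r := Rmax (norm (plus (Bs x0) (d 0))) (norm (d 0)) + 1).
assert (hr : 0 < r).
{ pose proof (norm_ge_0 (d 0)). pose proof (Rmax_r (norm (plus (Bs x0) (d 0))) (norm (d 0))).
  unfold r. lra. }
assert (hdiss := truncated_feedback_dissipation r (norm (sigma (d 0))) x0 (d 0) hr).
rewrite (radial_id r hr) in hdiss
  by (pose proof (Rmax_l (norm (plus (Bs x0) (d 0))) (norm (d 0))); unfold r; lra).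
rewrite hx0 in h.
specialize (hdiss ltac:(pose proof (Rmax_r (norm (plus (Bs x0) (d 0))) (norm (d 0)));
  unfold r; lra) (Rle_refl _)).
assert (h' : s * (- 2 * alpha * norm x0 ^ 2
                  - 2 * ipV x0 (B (sigma (plus (Bs x0) (d 0)))) + eps) <=
             s * (- alpha * norm x0 ^ 2
                  + 4 * b ^ 2 * norm (sigma (d 0)) ^ 2 / alpha + eps))
  by (apply Rmult_le_compat_l; lra).
lra.
Qed.

End Feedback.

(** * Essential suprema and comparison functions *)

Lemma sum_n_nonneg (h : nat -> R) (N : nat) : (forall i, 0 <= h i) -> 0 <= sum_n h N.
Proof.
intros hpos. induction N as [| N IH]; [rewrite sum_O; apply hpos |].
rewrite sum_Sn. exact (Rplus_le_le_0_compat _ _ IH (hpos (S N))).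
Qed.

Lemma sum_n_ge_term (h : nat -> R) (n k : nat) :
  (forall i, 0 <= h i) -> h n <= sum_n h (n + k).
Proof.
intros hpos. induction k as [| k IH].
- rewrite Nat.add_0_r. destruct n as [| n]; [rewrite sum_O; lra |].
  rewrite sum_Sn. change (h (S n) <= sum_n h n + h (S n)).
  pose proof (sum_n_nonneg h n hpos). lra.
- rewrite Nat.add_succ_r, sum_Sn.
  change (h n <= sum_n h (n + k) + h (S (n + k))). specialize (hpos (S (n + k))). lra.
Qed.

Lemma sum_n_index_le (h : nat -> R) (n k : nat) :
  (forall i, 0 <= h i) -> sum_n h n <= sum_n h (n + k).
Proof.
intros hpos. induction k as [| k IH]; [rewrite Nat.add_0_r; lra |].
rewrite Nat.add_succ_r, sum_Sn.
change (sum_n h n <= sum_n h (n + k) + h (S (n + k))). specialize (hpos (S (n + k))). lra.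
Qed.

(** Interval induction replaces Heine-Borel: the claim carried along is that finitely many
    intervals, cut at [t], already have total length at least [t - c]. *)
Lemma interval_cover_length (a b : nat -> R) (c d eps : R) :
  c <= d -> (forall n, a n <= b n) ->
  (forall s, c <= s <= d -> exists n, a n < s < b n) ->
  (forall n, sum_n (fun i => b i - a i) n <= eps) -> d - c <= eps.
Proof.
intros hcd hab hcover hsum.
(* [g i t] is the length of [(a i, b i)] to the left of [t]. *)
set (g := fun i t => Rmax 0 (Rmin (b i) t - a i)).
assert (hg0 : forall i t, 0 <= g i t) by (intros; apply Rmax_l).
assert (hgmono : forall i s t, s <= t -> 0 <= g i t - g i s).
{ intros i s t hst. unfold g, Rmax, Rmin. repeat destruct Rle_dec; lra. }
assert (hprog : exists N, d - c <= sum_n (fun i => g i d) N).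
{ apply (interval_induction (fun t => exists N, t - c <= sum_n (fun i => g i t) N) c d);
    [| lra].
  intros t ht IH. destruct (hcover t ht) as [n hn].
  exists (b n - t). split; [lra |]. intros s hs _.
  (* If the interval around [t] starts before [c], it suffices alone. Otherwise the hypothesis at
     the midpoint [s0] of [a n] and [t] pays for [[c, s0]], and interval [n] contains all of
     [[s0, s]]. *)
  destruct (Rlt_le_dec (a n) c) as [hac | hac].
  - exists (n + 0)%nat. apply Rle_trans with (2 := sum_n_ge_term (fun i => g i s) n 0 (fun i => hg0 i s)).
    unfold g, Rmax, Rmin. repeat destruct Rle_dec; lra.
  - destruct (IH ((a n + t) / 2)) as [N0 hN0]; [lra |].
    set (s0 := (a n + t) / 2) in *.
    exists (n + N0)%nat.
    assert (hsplit : sum_n (fun i => g i s) (n + N0) =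
              sum_n (fun i => g i s0) (n + N0) + sum_n (fun i => g i s - g i s0) (n + N0)).
    { rewrite <- (sum_n_plus (fun i => g i s0) (fun i => g i s - g i s0)).
      apply sum_n_ext. intros i. change (g i s = g i s0 + (g i s - g i s0)). ring. }
    rewrite hsplit.
    pose proof (sum_n_index_le (fun i => g i s0) N0 n (fun i => hg0 i s0)) as h1.
    rewrite Nat.add_comm in h1.
    pose proof (sum_n_ge_term (fun i => g i s - g i s0) n N0
      (fun i => hgmono i s0 s ltac:(unfold s0; lra))) as h2.
    assert (h3 : g n s - g n s0 = s - s0).
    { unfold g, s0, Rmax, Rmin. repeat destruct Rle_dec; lra. }
    simpl in h2. lra. }
destruct hprog as [N hN].
apply Rle_trans with (1 := hN), Rle_trans with (2 := hsum N).
apply sum_n_m_le. intros i. unfold g, Rmax, Rmin.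
specialize (hab i). repeat destruct Rle_dec; lra.
Qed.

Lemma interval_not_null (c d : R) (E : R -> Prop) :
  c < d -> (forall s, c <= s <= d -> E s) -> ~ null_set E.
Proof.
intros hcd hE hnull.
destruct (hnull ((d - c) / 2)) as [a [b [hab [hcover hsum]]]]; [lra |].
assert (d - c <= (d - c) / 2).
{ apply (interval_cover_length a b); try assumption; [lra |].
  intros s hs. apply hcover, hE, hs. }
lra.
Qed.

Lemma Linf_norm_nonneg {k : scalars} {U : HilbertSpace k} (d : R -> U) (t : Rbar) :
  Rbar_le 0 (Linf_norm d t).
Proof. apply (proj2 (Glb_Rbar_correct _)). intros M [hM _]. exact hM. Qed.

Lemma norm_le_Linf_norm {k : scalars} {U : HilbertSpace k} (d : R -> U) (s : R) (t : Rbar) :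
  continuous_disturbance d -> 0 <= s -> Rbar_lt s t ->
  Rbar_le (norm (d s)) (Linf_norm d t).
Proof.
intros hd hs hst. apply (proj2 (Glb_Rbar_correct _)). intros M [_ hM].
apply Rnot_lt_le. intros hlt.
destruct (proj1 (filterlim_within_norm_iff (V := realify U) (fun r => 0 <= r) d s (d s))
  (hd s hs) (norm (d s) - M)) as [e [he h]]; [lra |].
assert (hst' : exists e', 0 < e' /\ forall r, r < s + e' -> Rbar_lt r t).
{ destruct t as [t | |]; [| | contradiction].
  - exists (t - s). simpl in *. split; [lra |]. intros r hr. lra.
  - exists 1. split; [lra |]. intros r _. exact I. }
destruct hst' as [e' [he' hr']].
set (m := Rmin e e').
assert (hm : 0 < m) by (apply Rmin_glb_lt; assumption).
assert (hme : m <= e) by apply Rmin_l.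
assert (hme' : m <= e') by apply Rmin_r.
(* Strictly to the right of [s], since the essential supremum ranges over positive times and [s] may
   be 0. *)
refine (interval_not_null (s + m / 3) (s + m / 2) _ _ _ hM); [lra |].
intros r hr. split; [lra |]. split; [apply hr'; lra |].
specialize (h r ltac:(apply Rabs_def1; lra) ltac:(lra)).
pose proof (norm_triangle_inv (V := realify U) (d r) (d s)) as h1.
apply Rabs_le_between in h1.
assert (h2 : norm (minus (d s) (d r)) = norm (minus (d r) (d s)))
  by exact (norm_minus_sym (V := realify U) (d s) (d r)).
change (- norm (minus (d r) (d s)) <= norm (d r) - norm (d s) <=
        norm (minus (d r) (d s))) in h1.
change (norm (minus (d r) (d s)) < norm (d s) - M) in h. lra.
Qed.

(** Meant for gains of saturating feedbacks, which may be bounded and constant on intervals: the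
    identity supplies strictness and unboundedness. *)
Lemma class_Kinf_plus_id (g : R -> R) :
  (forall r, 0 <= r -> 0 <= g r) -> continuous_on (fun r => 0 <= r) g ->
  (forall r s, 0 <= r -> r <= s -> g r <= g s) -> g 0 = 0 ->
  class_Kinf (fun r => g r + r).
Proof.
intros hpos hcont hmono h0. split; [repeat split |].
- intros r hr. specialize (hpos r hr). lra.
- intros r hr. eapply filterlim_comp_2; [exact (hcont r hr) | |].
  + exact (filter_le_within (F := locally r) _).
  + apply (filterlim_plus (V := R_NormedModule)).
- intros r s hr hrs. specialize (hmono r s hr ltac:(lra)). lra.
- lra.
- intros M. exists (Rabs M + 1). pose proof (Rabs_pos M). pose proof (Rle_abs M).
  specialize (hpos (Rabs M + 1) ltac:(lra)). lra.
Qed.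

Lemma class_Kinf_square (c : R) : 0 < c -> class_Kinf (fun r => c * r ^ 2).
Proof.
intros hc. split; [repeat split |].
- intros r _. apply Rmult_le_pos; [lra | apply pow2_ge_0].
- apply continuous_on_forall. intros r _.
  apply (ex_derive_continuous (fun r => c * r ^ 2)). auto_derive. exact I.
- intros r s hr hrs. apply Rmult_lt_compat_l; [exact hc | nra].
- ring.
- intros M. exists (Rabs M / c + 1).
  assert (hq : 0 <= Rabs M / c) by (apply Rdiv_le_0_compat; [apply Rabs_pos | exact hc]).
  split; [lra |]. pose proof (Rle_abs M).
  apply Rle_lt_trans with (c * (Rabs M / c)).
  + replace (c * (Rabs M / c)) with (Rabs M) by (field; lra). assumption.
  + apply Rmult_lt_compat_l; [exact hc | nra].
Qed.

Lemma class_KL_exp (a : R) : 0 < a -> class_KL (fun r t => exp (- a * t) * r).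
Proof.
intros ha. repeat split.
- intros r t hr _. apply Rmult_le_pos; [left; apply exp_pos | exact hr].
- apply continuous_on_forall. intros p _.
  apply (continuous_mult (K := R_AbsRing) (fun p : R * R => exp (- a * snd p)) fst);
    [| apply continuous_fst].
  apply (continuous_comp snd (fun t => exp (- a * t))); [apply continuous_snd |].
  apply (ex_derive_continuous (fun t => exp (- a * t))). auto_derive. exact I.
- intros r hr. apply Rmult_le_pos; [left; apply exp_pos | exact hr].
- apply continuous_on_forall. intros r _.
  apply (ex_derive_continuous (fun r => exp (- a * t) * r)). auto_derive. exact I.
- intros r s _ hrs. apply Rmult_lt_compat_l; [apply exp_pos | exact hrs].
- ring.
- intros t _. apply Rmult_le_pos; [left; apply exp_pos | lra].
- apply continuous_on_forall. intros t _.
  apply (ex_derive_continuous (fun t => exp (- a * t) * r)). auto_derive. exact I.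
- intros s t _ hst. apply Rmult_lt_compat_r; [assumption |].
  apply exp_increasing. nra.
- apply is_lim_ext with (fun t => r * exp (- a * t)); [intros t; ring |].
  replace (Finite 0) with (Rbar_mult r 0) by (simpl; f_equal; ring).
  apply is_lim_scal_l.
  apply (is_lim_comp exp (fun t => - a * t) p_infty 0 m_infty).
  + apply is_lim_exp_m.
  + replace m_infty with (Rbar_mult (- a) p_infty).
    * apply is_lim_scal_l, is_lim_id.
    * simpl. destruct (Rle_dec 0 (- a)); [exfalso; lra | reflexivity].
  + exists 0. intros t _. discriminate.
Qed.

(** A supremum over the ball is used instead of [kr * r] because the local Lipschitz constants carry
    no regularity in [r]. It is finite for [0 <= r], so [real] loses nothing there. *)
Definition gain {W : CompleteNormedModule R_AbsRing} (sigma : W -> W) (r : R) : R :=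
  real (Lub_Rbar (fun y => exists u : W, norm u <= r /\ y = norm (sigma u))).

Section Gain.

Context {W : CompleteNormedModule R_AbsRing} {ip : W -> W -> R} (hip : is_inner ip)
  {sigma : W -> W} (hsigma0 : sigma zero = zero)
  (hsigma_lip : forall r, 0 < r -> exists k, 0 < k /\
     forall u v : W, norm u <= r -> norm v <= r ->
       norm (minus (sigma u) (sigma v)) <= k * norm (minus u v)).

Lemma gain_lub (r : R) : 0 <= r ->
  (forall u : W, norm u <= r -> norm (sigma u) <= gain sigma r) /\
  (forall M, (forall u : W, norm u <= r -> norm (sigma u) <= M) -> gain sigma r <= M).
Proof.
intros hr. unfold gain.
set (E := fun y => exists u : W, norm u <= r /\ y = norm (sigma u)).
(* Radius [r + 1], since [r] may be 0 and the hypothesis asks for a positive radius. *)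
destruct (hsigma_lip (r + 1)) as [k [hk hlip]]; [lra |].
assert (hz : norm (zero : W) = 0) by exact (norm_zero (V := W)).
assert (hbound : forall u, norm u <= r -> norm (sigma u) <= k * r).
{ intros u hu.
  assert (hr1 : 0 <= r + 1) by lra.
  pose proof (hlip u zero ltac:(lra) (Rle_trans _ _ _ (Req_le _ _ hz) hr1)) as h. rewrite hsigma0 in h.
  assert (hm : forall u : W, minus u zero = u) by (intros v; vec_eq hip).
  rewrite !hm in h. apply Rle_trans with (1 := h). apply Rmult_le_compat_l; lra. }
destruct (Lub_Rbar_correct E) as [hub hlub].
assert (hfin : is_finite (Lub_Rbar E)).
{
  assert (h1 : Rbar_le (Lub_Rbar E) (k * r)).
  { apply hlub. intros y [u [hu ->]]. apply hbound, hu. }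
  assert (h2 : Rbar_le (norm (sigma zero)) (Lub_Rbar E)).
  { apply hub. exists zero. split; [exact (Rle_trans _ _ _ (Req_le _ _ hz) hr) | reflexivity]. }
  destruct (Lub_Rbar E); [reflexivity | contradiction | contradiction]. }
split.
- intros u hu. assert (h : Rbar_le (norm (sigma u)) (Lub_Rbar E))
    by (apply hub; exists u; split; [exact hu | reflexivity]).
  rewrite <- hfin in h. exact h.
- intros M hM. assert (h : Rbar_le (Lub_Rbar E) M)
    by (apply hlub; intros y [u [hu ->]]; apply hM, hu).
  rewrite <- hfin in h. exact h.
Qed.

Lemma gain_nonneg (r : R) : 0 <= r -> 0 <= gain sigma r.
Proof.
intros hr. apply Rle_trans with (1 := norm_ge_0 (sigma zero)).
apply gain_lub; [exact hr |].
exact (Rle_trans _ _ _ (Req_le _ _ (norm_zero (V := W))) hr).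
Qed.

Lemma gain_mono (r s : R) : 0 <= r -> r <= s -> gain sigma r <= gain sigma s.
Proof.
intros hr hrs. apply gain_lub; [exact hr |]. intros u hu.
apply gain_lub; lra.
Qed.

Lemma gain_zero : gain sigma 0 = 0.
Proof.
apply Rle_antisym; [| apply gain_nonneg; lra].
apply gain_lub; [lra |]. intros u hu.
assert (hu0 : u = (zero : W))
  by (apply (norm_eq_zero (V := W)), Rle_antisym; [exact hu | apply norm_ge_0]).
rewrite hu0, hsigma0. right. exact (norm_zero (V := W)).
Qed.

(** Shrinking a vector of the ball of radius [t] by [s / t] lands in the ball of radius [s] and
    moves it by at most [t - s]. Hence the gain inherits the local Lipschitz constant of [sigma]. *)
Lemma gain_continuous : continuous_on (fun r => 0 <= r) (gain sigma).
Proof.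
intros r hr. apply (filterlim_within_norm_iff (V := R_CompleteNormedModule)).
intros eps heps.
destruct (hsigma_lip (r + 1)) as [k [hk hlip]]; [lra |].
assert (hgain : forall s t, 0 <= s -> s <= t -> t <= r + 1 -> gain sigma t <= gain sigma s + k * (t - s)).
{ intros s t hs hst ht. apply gain_lub; [lra |]. intros u hu.
  assert (hv : exists v : W, norm v <= s /\ norm (minus u v) <= t - s).
  { destruct (Req_dec t 0) as [ht0 | ht0].
    - exists u. rewrite norm_minus_diag. lra.
    - exists (scal (s / t) u).
      assert (heq : minus u (scal (s / t) u) = scal ((t - s) / t) u)
        by (vec_eq hip; field; exact ht0).
      rewrite heq, !(norm_scal_R hip).
      rewrite !Rabs_pos_eq by (apply Rdiv_le_0_compat; lra).
      split.
      + replace s with (s / t * t) at 2 by (field; exact ht0).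
        apply Rmult_le_compat_l; [apply Rdiv_le_0_compat; lra | exact hu].
      + replace (t - s) with ((t - s) / t * t) at 2 by (field; exact ht0).
        apply Rmult_le_compat_l; [apply Rdiv_le_0_compat; lra | exact hu]. }
  destruct hv as [v [hv huv]].
  pose proof (norm_triangle_inv (sigma u) (sigma v)) as h1.
  apply Rabs_le_between in h1. destruct h1 as [_ h1].
  assert (h2 := Rle_trans _ _ _ h1 (hlip u v ltac:(lra) ltac:(lra))).
  assert (h3 : norm (sigma v) <= gain sigma s) by (apply gain_lub; assumption).
  assert (h4 : k * norm (minus u v) <= k * (t - s)) by (apply Rmult_le_compat_l; lra).
  lra. }
exists (Rmin 1 (eps / k)).
split. { apply Rmin_glb_lt; [lra | apply Rdiv_lt_0_compat; assumption]. }
intros s hs hs0.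
assert (hs1 := Rlt_le_trans _ _ _ hs (Rmin_l _ _)).
assert (hs2 := Rlt_le_trans _ _ _ hs (Rmin_r _ _)).
assert (hks : k * Rabs (s - r) < eps).
{ replace eps with (k * (eps / k)) by (field; lra). apply Rmult_lt_compat_l; assumption. }
apply Rabs_def2 in hs1.
change (Rabs (gain sigma s - gain sigma r) < eps). apply Rle_lt_trans with (2 := hks).
destruct (Rle_lt_dec r s) as [hrs | hrs].
- rewrite (Rabs_pos_eq (s - r)) by lra.
  pose proof (hgain r s ltac:(lra) hrs ltac:(lra)).
  pose proof (gain_mono r s hr hrs). rewrite Rabs_pos_eq; lra.
- rewrite (Rabs_left1 (s - r)) by lra.
  pose proof (hgain s r hs0 ltac:(lra) ltac:(lra)).
  pose proof (gain_mono s r hs0 ltac:(lra)). rewrite Rabs_left1; lra.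
Qed.

(** Exponent 2 serves the Lyapunov inequality and exponent 1 the ISS estimate; a positive exponent
    keeps the value 0 at 0. *)
Lemma class_Kinf_gain (c : R) (n : nat) : 0 <= c ->
  class_Kinf (fun r => c * gain sigma r ^ Datatypes.S n + r).
Proof.
intros hc. apply (class_Kinf_plus_id (fun r => c * gain sigma r ^ Datatypes.S n)).
- intros r hr. apply Rmult_le_pos; [exact hc | apply pow_le, gain_nonneg, hr].
- intros r hr.
  apply (filterlim_comp _ _ _ (gain sigma) (fun y => c * y ^ Datatypes.S n) _ (locally (gain sigma r)));
    [exact (gain_continuous r hr) |].
  apply (ex_derive_continuous (fun y => c * y ^ Datatypes.S n)).
  auto_derive. exact I.
- intros r s hr hrs. apply Rmult_le_compat_l; [exact hc |].
  apply pow_incr. split; [apply gain_nonneg, hr | apply gain_mono; assumption].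
- rewrite gain_zero. simpl. ring.
Qed.

End Gain.

(** * Restriction of scalars and mild solutions *)

Lemma is_inner_realify (k : scalars) (X : HilbertSpace k) :
  is_inner (V := realify X) (fun x y : X => re_part k (inner X x y)).
Proof.
destruct k; split.
- intros x y z. exact (inner_plus_l _ X x y z).
- intros a x y. exact (inner_scal_l _ X a x y).
- intros x y. symmetry. exact (inner_conj _ X x y).
- intros x. exact (inner_norm _ X x).
- intros x y z. exact (f_equal Re (inner_plus_l _ X x y z)).
- intros a x y.
  change (Re (inner X (scal (RtoC a : field_of ComplexScalars) x) y) = a * Re (inner X x y)).
  rewrite inner_scal_l. generalize (inner X x y). intros w.
  change (a * fst (w : C) - 0 * snd (w : C) = a * fst (w : C)). ring.
- intros x y.
  change (Re (inner X x y) = Re (inner X y x)). rewrite (inner_conj _ X x y). reflexivity.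
- intros x. exact (f_equal Re (inner_norm _ X x)).
Qed.

Lemma is_linear_realify {k : scalars} {X U : HilbertSpace k} (L : U -> X) :
  is_linear L -> is_linear (U := realify U) (V := realify X) L.
Proof.
intros hL. split.
- exact (linear_plus _ hL).
- intros r x. exact (linear_scal _ hL (of_R k r) x).
- exact (linear_norm _ hL).
Qed.

Lemma op_norm_bound {k : scalars} {X : HilbertSpace k} (L : X -> X) (c : R) :
  is_linear L -> Rbar_le (op_norm L) c -> forall x, norm (L x) <= c * norm x.
Proof.
intros hL hc x.
pose proof (is_inner_realify k X) as hip.
destruct (Req_dec (norm x) 0) as [h0 | h0].
- destruct (linear_norm _ hL) as [M [_ hM]]. specialize (hM x). rewrite h0 in *. lra.
- assert (hx : 0 < norm x) by (pose proof (norm_ge_0 x); lra).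
  set (v := scal (/ norm x) (x : realify X)).
  assert (hv : norm (v : X) = 1).
  { change (norm (scal (/ norm x) (x : realify X)) = 1).
    rewrite (norm_scal_R hip), Rabs_pos_eq by (left; apply Rinv_0_lt_compat, hx).
    apply Rinv_l. exact h0. }
  assert (hLv : norm (L v) = / norm x * norm (L x)).
  { assert (heq : L v = scal (/ norm x) (L x : realify X))
      by exact (linear_scal _ hL (of_R k (/ norm x)) x).
    rewrite heq. rewrite <- (Rabs_pos_eq (/ norm x)) at 2
      by (left; apply Rinv_0_lt_compat, hx).
    exact (norm_scal_R hip (/ norm x) (L x)). }
  assert (h : Rbar_le (norm (L v)) c).
  { apply Rbar_le_trans with (2 := hc). apply (proj1 (Lub_Rbar_correct _)).
    exists v. split; [right; exact hv | reflexivity]. }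
  simpl in h. rewrite hLv in h.
  apply (Rmult_le_compat_l (norm x)) in h; [| lra].
  rewrite <- Rmult_assoc, Rinv_r, Rmult_1_l in h by exact h0. lra.
Qed.

Lemma C0_semigroup_flow {k : scalars} {X : HilbertSpace k} (T : R -> X -> X) (alpha : R) :
  is_C0_semigroup T ->
  (forall t, 0 < t -> Rbar_le (op_norm (T t)) (exp (- alpha * t))) ->
  contraction_flow (V := realify X) alpha (fun t => T (Rmax 0 t)).
Proof.
intros hT hexp. split.
- intros t. apply is_linear_realify, (C0_linear _ hT), Rmax_l.
- intros t x ht. rewrite Rmax_left by exact ht. apply (C0_zero _ hT).
- intros s t x hs ht. rewrite !Rmax_right by lra. apply (C0_plus _ hT); assumption.
- intros t x ht. rewrite Rmax_right by exact ht.
  destruct ht as [ht | <-].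
  + apply op_norm_bound; [apply (C0_linear _ hT); lra | apply hexp, ht].
  + rewrite (C0_zero _ hT), Rmult_0_r, exp_0, Rmult_1_l. apply Rle_refl.
- intros x eps heps.
  destruct (proj1 (filterlim_within_norm_iff (V := realify X) (fun u => 0 < u)
    (fun t => T t x) 0 x) (C0_cont _ hT x) eps heps) as [d [hd h]].
  exists d. split; [exact hd |]. intros t ht. rewrite Rmax_right by lra.
  destruct (proj1 ht) as [ht0 | ht0].
  + apply h; [rewrite Rminus_0_r, Rabs_pos_eq; lra | exact ht0].
  + rewrite <- ht0, (C0_zero _ hT).
    apply Rle_lt_trans with (2 := heps). right. exact (norm_minus_diag (V := realify X) x).
Qed.

Lemma limsup_right0_le (f : R -> R) (c : R) :
  (forall eps, 0 < eps -> exists delta, 0 < delta /\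
     forall t, 0 < t < delta -> f t <= c + eps) ->
  Rbar_le (limsup_right0 f) c.
Proof.
intros hf. unfold limsup_right0, Rbar_glb.
match goal with |- Rbar_le (proj1_sig ?s) _ => destruct s as [l [hlb hgreatest]] end. simpl.
assert (hl : forall eps, 0 < eps -> Rbar_le l (c + eps)).
{ intros eps heps. destruct (hf eps heps) as [delta [hdelta h]].
  apply Rbar_le_trans with (1 := hlb _ (ex_intro _ delta (Logic.conj hdelta eq_refl))).
  apply (proj2 (Lub_Rbar_correct _)). intros r [t [ht ->]]. apply h, ht. }
destruct l as [l | |]; simpl in *; [| exact (hl 1 Rlt_0_1) | exact I].
apply le_epsilon. exact hl.
Qed.

(** * Transfer to mild solutions of the original system *)

Section MildSolutions.

Context {k : scalars} {X U : HilbertSpace k} {T : R -> X -> X} {alpha : R}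
  (halpha : 0 < alpha) (hT : is_C0_semigroup T)
  (hexp : forall t, 0 < t -> Rbar_le (op_norm (T t)) (exp (- alpha * t)))
  {B : U -> X} {Bs : X -> U} (hB : is_linear B) (hBs : is_adjoint B Bs)
  {b : R} (hb : 0 < b) (hBnorm : forall u, norm (B u) <= b * norm u)
  {sigma : U -> U} (hsigma : admissible_feedback sigma).

Let E := realify X.
Let F := realify U.
Let ipE : E -> E -> R := fun x y => re_part k (inner X x y).
Let ipF : F -> F -> R := fun x y => re_part k (inner U x y).
Let S : R -> E -> E := fun t => T (Rmax 0 t).
Let ext (d : R -> U) : R -> F := fun s => d (Rmax 0 s).

Let hipE : is_inner ipE := is_inner_realify k X.
Let hipF : is_inner ipF := is_inner_realify k U.
Let hS : contraction_flow alpha S := C0_semigroup_flow T alpha hT hexp.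
Let hB' : is_linear (U := F) (V := E) B := is_linear_realify B hB.
Let hBs' : forall (u : F) (x : E), ipE (B u) x = ipF u (Bs x) :=
  fun u x => f_equal (re_part k) (hBs u x).
Let hsigma0 : sigma (zero : F) = (zero : F) := proj1 hsigma.
Let hsigma_lip : forall r, 0 < r -> exists kr, 0 < kr /\
     forall u v : F, norm u <= r -> norm v <= r ->
       norm (minus (sigma u : F) (sigma v)) <= kr * norm (minus u v) :=
  proj1 (proj2 hsigma).
Let hsigma_mono : forall u v : F, 0 <= ipF (minus (sigma u : F) (sigma v)) (minus u v) :=
  proj2 (proj2 hsigma).

Let solution (x0 : X) (d : R -> U) (t1 : R) (x : R -> E) : Prop :=
  is_solution (V := E) (W := F) S B Bs sigma x0 (ext d) t1 x.

Lemma disturbance_ext_continuous (d : R -> U) :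
  continuous_disturbance d -> forall t, continuous (ext d) t.
Proof.
intros hd. apply (continuous_on_comp_nonexpansive (V := F) (fun t => 0 <= t) d (Rmax 0)).
- exact hd.
- intros t. apply Rmax_l.
- apply Rmax_0_nonexpansive.
Qed.

Lemma convolution_integrand_eq (x y : R -> X) (d : R -> U) (t s : R) :
  0 < s < t -> x s = y s ->
  T (t - s) (B (sigma (plus (Bs (x s)) (d s)))) =
  S (t - s) (B (sigma (plus (Bs (y s) : F) (ext d s)))).
Proof.
intros hs hxy. unfold S, ext. rewrite !Rmax_right by lra. rewrite hxy. reflexivity.
Qed.

(** Freezing [y] outside [[0, t1]] gives global continuity and leaves the integrands on [(0, t)]
    unchanged. *)
Lemma solution_of_mild (x0 : X) (d : R -> U) (t1 : R) (y : R -> X) : 0 <= t1 ->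
  mild_solution_on T B Bs sigma x0 d t1 y ->
  solution x0 d t1 (fun t => y (clamp t1 t)).
Proof.
intros ht1 [hcont hy]. split.
- apply (continuous_on_comp_nonexpansive (V := E) (fun t => 0 <= t <= t1) y (clamp t1)).
  + exact hcont.
  + intros t. apply clamp_range, ht1.
  + apply clamp_nonexpansive.
- intros t ht. rewrite clamp_id by exact ht.
  destruct (hy t ht) as [_ heq].
  assert (hint : RInt (V := E) (fun s => T (t - s) (B (sigma (plus (Bs (y s)) (d s))))) 0 t =
    RInt (fun s => S (t - s) (B (sigma (plus (Bs (y (clamp t1 s)) : F) (ext d s))))) 0 t).
  { apply (RInt_ext (V := E)). intros s. rewrite Rmin_left, Rmax_right by lra. intros hs.
    apply (convolution_integrand_eq y (fun s => y (clamp t1 s))); [exact hs |].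
    rewrite clamp_id by lra. reflexivity. }
  refine (eq_trans heq (f_equal2 (fun u v : E => minus u v) _ hint)).
  unfold S. rewrite Rmax_right by lra. reflexivity.
Qed.

Lemma mild_of_solution (x0 : X) (d : R -> U) (t1 : R) (x : R -> E) :
  continuous_disturbance d -> solution x0 d t1 x ->
  mild_solution_on T B Bs sigma x0 d t1 x.
Proof.
intros hd [hcont hx]. split.
- apply (continuous_on_forall (U := E)). intros t _. apply hcont.
- intros t ht.
  assert (hint : is_RInt (V := E) (fun s => T (t - s) (B (sigma (plus (Bs (x s)) (d s))))) 0 t
    (RInt (fun s => S (t - s) (B (sigma (plus (Bs (x s) : F) (ext d s))))) 0 t)).
  { apply (is_RInt_ext (V := E)
      (fun s => S (t - s) (B (sigma (plus (Bs (x s) : F) (ext d s)))))).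
    - intros s. rewrite Rmin_left, Rmax_right by lra. intros hs.
      symmetry. apply convolution_integrand_eq; [exact hs | reflexivity].
    - apply (RInt_correct (V := E)), (ex_RInt_convolution halpha hS
        (f := fun s => B (sigma (plus (Bs (x s) : F) (ext d s))))).
      apply (continuous_feedback hipE hipF hb hB' hBnorm hBs' hsigma_lip);
        [exact hcont | apply disturbance_ext_continuous, hd]. }
  split; [exists (RInt (fun s => S (t - s) (B (sigma (plus (Bs (x s) : F) (ext d s))))) 0 t);
          exact hint |].
  refine (eq_trans (hx t ht) (f_equal2 (fun u v : E => minus u v) _
    (eq_sym (is_RInt_unique (V := E) _ _ _ _ hint)))).
  unfold S. rewrite Rmax_right by lra. reflexivity.
Qed.

Lemma mild_solution_on_ext (x0 : X) (d : R -> U) (t1 : R) (x y : R -> X) :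
  (forall t, 0 <= t <= t1 -> x t = y t) ->
  mild_solution_on T B Bs sigma x0 d t1 x -> mild_solution_on T B Bs sigma x0 d t1 y.
Proof.
intros hxy [hcont hx]. split.
- apply (continuous_on_ext (U := E)) with x; [exact hxy | exact hcont].
- intros t ht. destruct (hx t ht) as [[l hl] heq].
  assert (hint : is_RInt (V := E) (fun s => T (t - s) (B (sigma (plus (Bs (y s)) (d s))))) 0 t l).
  { apply (is_RInt_ext (V := E)) with (2 := hl). intros s.
    rewrite Rmin_left, Rmax_right by lra. intros hs. rewrite hxy by lra. reflexivity. }
  split; [exists l; exact hint |].
  rewrite <- hxy by exact ht.
  refine (eq_trans heq (f_equal (fun v : E => minus (T t x0 : E) v) _)).
  exact (eq_trans (is_RInt_unique (V := E) _ _ _ _ hl)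
    (eq_sym (is_RInt_unique (V := E) _ _ _ _ hint))).
Qed.

Lemma mild_solution_unique (x0 : X) (d : R -> U) (t1 t2 : R) (x y : R -> X) :
  continuous_disturbance d -> 0 <= t1 <= t2 ->
  mild_solution_on T B Bs sigma x0 d t1 x -> mild_solution_on T B Bs sigma x0 d t2 y ->
  forall t, 0 <= t <= t1 -> x t = y t.
Proof.
intros hd ht12 hx [hycont hy] t ht.
assert (hy1 : mild_solution_on T B Bs sigma x0 d t1 y).
{ split; [| intros s hs; apply hy; lra].
  apply (continuous_on_subset (U := E)) with (2 := hycont). intros s hs. lra. }
pose proof (solution_unique hipE hipF halpha hS hb hB' hBnorm hBs' hsigma_lip hsigma_mono
  x0 (ext d) t1 _ _ (disturbance_ext_continuous d hd)
  (solution_of_mild x0 d t1 x ltac:(lra) hx) (solution_of_mild x0 d t1 y ltac:(lra) hy1) t ht) as h.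
cbv beta in h. rewrite clamp_id in h by exact ht. exact h.
Qed.

Lemma global_mild_solution (x0 : X) (d : R -> U) : continuous_disturbance d ->
  exists x, maximal_mild_solution T B Bs sigma x0 d p_infty x.
Proof.
intros hd.
assert (hex : forall t1, 0 <= t1 -> exists y, mild_solution_on T B Bs sigma x0 d t1 y).
{ intros t1 ht1.
  destruct (solution_exists hipE hipF halpha hS hb hB' hBnorm hBs' hsigma0 hsigma_lip
    hsigma_mono x0 (ext d) t1 ht1 (disturbance_ext_continuous d hd)) as [y hy].
  exists y. apply mild_of_solution; assumption. }
(* [x t] is the common value at [t] of all mild solutions that reach [t]. Uniqueness makes the
   description definite, so [x] agrees with every mild solution, which is also the maximality
   clause. *)
set (x := fun t => iota (T := CompleteNormedModule.CompleteSpace _ E) (fun v : X => exists t1 y,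
  0 <= t <= t1 /\ mild_solution_on T B Bs sigma x0 d t1 y /\ v = y t)).
assert (hx : forall t1 y, mild_solution_on T B Bs sigma x0 d t1 y ->
          forall t, 0 <= t <= t1 -> x t = y t).
{ intros t1 y hy t ht. apply (iota_unique (V := E)).
  - intros v [t2 [z [ht2 [hz ->]]]]. destruct (Rle_lt_dec t1 t2) as [h12 | h12].
    + symmetry. apply (mild_solution_unique x0 d t1 t2); try assumption. lra.
    + apply (mild_solution_unique x0 d t2 t1); try assumption. lra.
  - exists t1, y. split; [exact ht | split; [exact hy | reflexivity]]. }
exists x. split; [exact I |]. split.
- intros t1 ht1 _. destruct (hex t1 ltac:(lra)) as [y hy].
  apply mild_solution_on_ext with (2 := hy). intros t ht. symmetry. apply (hx t1); assumption.
- intros t1 y ht1 hy. split; [exact I |]. intros t ht. symmetry. apply (hx t1); assumption.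
Qed.

Lemma disturbance_gain (d : R -> U) (s L : R) (t : Rbar) :
  continuous_disturbance d -> 0 <= s -> Rbar_lt s t -> Linf_norm d t = Finite L ->
  norm (sigma (d s)) <= gain (W := F) sigma L.
Proof.
intros hd hs hst hL.
pose proof (norm_le_Linf_norm d s t hd hs hst) as h. rewrite hL in h.
apply (gain_lub hipF hsigma0 hsigma_lip); [| exact h].
apply Rle_trans with (2 := h), norm_ge_0.
Qed.

Lemma Lyapunov_decay (x0 : X) (d : R -> U) (x : R -> X) :
  continuous_disturbance d -> maximal_mild_solution T B Bs sigma x0 d p_infty x ->
  Rbar_le (limsup_right0 (fun t => / t * (norm (x t) ^ 2 - norm x0 ^ 2)))
    (Rbar_plus (- (alpha * norm x0 ^ 2))
       (Rbar_ext (fun r => 4 * b ^ 2 / alpha * gain (W := F) sigma r ^ 2 + r)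
          (Linf_norm d p_infty))).
Proof.
intros hd [_ [hx _]].
pose proof (Linf_norm_nonneg d p_infty) as hL0.
destruct (Linf_norm d p_infty) as [L | |] eqn:hL; [| destruct limsup_right0; exact I | contradiction].
simpl in hL0.
(* The derivative at time zero sees the disturbance only through [d 0], whose norm continuity bounds
   by the essential supremum. *)
apply Rbar_le_trans with
  (Finite (- (alpha * norm x0 ^ 2) + 4 * b ^ 2 / alpha * norm (sigma (d 0)) ^ 2)).
- apply limsup_right0_le. intros eps heps.
  pose proof (solution_of_mild x0 d 1 x Rle_0_1 (hx 1 Rlt_0_1 I)) as hsol.
  destruct (solution_dini_bound hipE hipF halpha hS hb hB' hBnorm hBs' hsigma0 hsigma_lip
    hsigma_mono 1 eps x0 (ext d) _ Rlt_0_1 heps (disturbance_ext_continuous d hd) hsol)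
    as [e [he h]].
  exists (Rmin e 1). split; [apply Rmin_glb_lt; lra |]. intros t ht.
  assert (hte : t < e) by (apply Rlt_le_trans with (1 := proj2 ht), Rmin_l).
  assert (ht1 : t < 1) by (apply Rlt_le_trans with (1 := proj2 ht), Rmin_r).
  specialize (h t ltac:(lra)). cbv beta in h. rewrite clamp_id in h by lra.
  unfold ext in h. rewrite Rmax_left in h by lra.
  change (norm (x t) ^ 2 - norm x0 ^ 2 <= t * (- alpha * norm x0 ^ 2 +
    4 * b ^ 2 * norm (sigma (d 0)) ^ 2 / alpha + eps)) in h.
  apply (Rmult_le_compat_l (/ t)) in h; [| left; apply Rinv_0_lt_compat; lra].
  rewrite <- Rmult_assoc, Rinv_l, Rmult_1_l in h by lra.
  apply Rle_trans with (1 := h). right. field. lra.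
- pose proof (disturbance_gain d 0 L p_infty hd (Rle_refl 0) I hL) as h.
  apply Rplus_le_compat_l.
  apply Rle_trans with (4 * b ^ 2 / alpha * gain (W := F) sigma L ^ 2); [| lra].
  apply Rmult_le_compat_l.
  + apply Rdiv_le_0_compat; [nra | exact halpha].
  + apply pow_incr. split; [apply norm_ge_0 | exact h].
Qed.

(** The square root of [solution_bound], by [p ^ 2 + q ^ 2 <= (p + q) ^ 2] for nonnegative [p], [q];
    this halves the decay rate to [alpha / 2]. *)
Lemma ISS_estimate (x0 : X) (d : R -> U) (x : R -> X) (t : R) :
  continuous_disturbance d -> maximal_mild_solution T B Bs sigma x0 d p_infty x -> 0 <= t ->
  Rbar_le (norm (x t))
    (Rbar_plus (exp (- (alpha / 2) * t) * norm x0)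
       (Rbar_ext (fun r => 2 * b / alpha * gain (W := F) sigma r ^ 1 + r) (Linf_norm d t))).
Proof.
intros hd [_ [hx _]] ht.
pose proof (Linf_norm_nonneg d t) as hL0.
destruct (Linf_norm d t) as [L | |] eqn:hL; [| exact I | contradiction].
simpl in hL0.
(* Horizon [t + 1], because mild solutions are given on intervals of positive length and [t] may be
   0. *)
pose proof (solution_of_mild x0 d (t + 1) x ltac:(lra) (hx (t + 1) ltac:(lra) I)) as [hxc hxeq].
assert (hsol : solution x0 d t (fun s => x (clamp (t + 1) s)))
  by (split; [exact hxc | intros s hs; apply hxeq; lra]).
pose proof (solution_bound hipE hipF halpha hS hb hB' hBnorm hBs' hsigma0 hsigma_lip
  hsigma_mono (gain (W := F) sigma L) t x0 (ext d) _ (disturbance_ext_continuous d hd) hsol) as h.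
assert (hM : forall s, 0 <= s < t -> norm (sigma (ext d s) : F) <= gain (W := F) sigma L).
{ intros s hs. unfold ext. rewrite Rmax_right by lra.
  apply (disturbance_gain d s L t hd); [lra | exact (proj2 hs) | exact hL]. }
specialize (h hM t (Logic.conj ht (Rle_refl t))). cbv beta in h.
rewrite clamp_id in h by lra.
pose proof (gain_nonneg hipF hsigma0 hsigma_lip L hL0) as hg.
set (g := gain (W := F) sigma L) in *.
change (norm (x t) ^ 2 <= exp (- alpha * t) * norm x0 ^ 2 + (2 * b * g / alpha) ^ 2) in h.
change (norm (x t) <= exp (- (alpha / 2) * t) * norm x0 + (2 * b / alpha * g ^ 1 + L)).
rewrite pow_1.
assert (he : exp (- alpha * t) = exp (- (alpha / 2) * t) ^ 2).
{ simpl. rewrite Rmult_1_r, <- exp_plus. f_equal. field. }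
rewrite he in h. set (e := exp (- (alpha / 2) * t)) in *.
assert (he0 : 0 <= e * norm x0) by (apply Rmult_le_pos; [left; apply exp_pos | apply norm_ge_0]).
assert (hq : 0 <= 2 * b * g / alpha) by (apply Rdiv_le_0_compat; [nra | exact halpha]).
replace (2 * b / alpha * g) with (2 * b * g / alpha) by (field; lra).
assert (hle : norm (x t) <= e * norm x0 + 2 * b * g / alpha).
{ apply Rsqr_incr_0; [| apply norm_ge_0 | lra]. rewrite !Rsqr_pow2. nra. }
apply Rle_trans with (1 := hle). lra.
Qed.

End MildSolutions.

Theorem theorem2
  (k : scalars) (X U : HilbertSpace k)
  (T : R -> X -> X) (DA : X -> Prop) (A : X -> X)
  (hT : is_contraction_semigroup T)
  (hA : is_generator T DA A)
  (B : U -> X) (Bs : X -> U)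
  (hB : is_linear B)
  (hBs : is_adjoint B Bs)
  (hexp : exists alpha : R, 0 < alpha /\
     forall t : R, 0 < t -> Rbar_le (op_norm (T t)) (exp (- alpha * t)))
  (sigma : U -> U)
  (hsigma : admissible_feedback sigma) :
  ISS_Lyapunov_continuous T B Bs sigma (fun x : X => norm x ^ 2) /\
  ISS_continuous T B Bs sigma.
Proof.
destruct hT as [hT _]. destruct hexp as [alpha [halpha hbound]].
destruct (linear_norm _ hB) as [b [hb hBnorm]].
assert (hgain : forall c n, 0 <= c ->
          class_Kinf (fun r => c * gain (W := realify U) sigma r ^ S n + r)).
{ intros c n. apply (class_Kinf_gain (W := realify U) (is_inner_realify k U)).
  - exact (proj1 hsigma).
  - exact (proj1 (proj2 hsigma)). }
assert (hsq : class_Kinf (fun r => 1 * r ^ 2)) by (apply class_Kinf_square; lra).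
split.
- split; [intros x; apply pow2_ge_0 |]. split.
  + intros x. apply (continuous_comp (fun y : X => norm y) (fun r => r ^ 2)).
    * exact (filterlim_norm x).
    * apply (ex_derive_continuous (fun r => r ^ 2)). auto_derive. exact I.
  + exists (fun r => 1 * r ^ 2), (fun r => 1 * r ^ 2), (fun r => alpha * r ^ 2),
      (fun r => 4 * b ^ 2 / alpha * gain (W := realify U) sigma r ^ 2 + r).
    repeat (split; [first [exact hsq | apply class_Kinf_square, halpha
      | apply hgain, Rdiv_le_0_compat; [nra | exact halpha]] |]).
    intros x0 d hd. split; [lra |].
    destruct (global_mild_solution halpha hT hbound hB hBs hb hBnorm hsigma x0 d hd) as [x hx].
    exists p_infty, x. split; [exact hx |].
    exact (Lyapunov_decay halpha hT hbound hB hBs hb hBnorm hsigma x0 d x hd hx).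
- exists (fun r t => exp (- (alpha / 2) * t) * r),
    (fun r => 2 * b / alpha * gain (W := realify U) sigma r ^ 1 + r).
  split; [apply class_KL_exp; lra |].
  split; [apply hgain, Rdiv_le_0_compat; lra |].
  intros x0 d hd.
  destruct (global_mild_solution halpha hT hbound hB hBs hb hBnorm hsigma x0 d hd) as [x hx].
  exists x. split; [exact hx |]. intros t ht.
  exact (ISS_estimate halpha hT hbound hB hBs hb hBnorm hsigma x0 d x t hd hx ht).
Qed.
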